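(* Let $J\in\mathbb{C}^{q\times q}$ be a signature matrix and let $f\in\mathbb{C}^{q\times q}\langle\langle z_1,\ldots,z_N\rangle\rangle_{\rm rat}$ be a rational formal power series which is matrix-$J$-inner in $\mathcal{D}_N$. Then there exists a minimal GR-realization $\alpha=(N;A,B,C,D;\mathbb{C}^\gamma=\bigoplus_{k=1}^N\mathbb{C}^{\gamma_k},\mathbb{C}^q)$ of $f$ whose associated structured Hermitian matrix is $H=I_\gamma$. Such a realization is unique up to a unitary similarity.
   Context: Formal power series. $\mathcal{F}_N$ is the free monoid on generators $g_1,\ldots,g_N$ with empty word $\emptyset$. A formal power series (FPS) in non-commuting indeterminates $z_1,\ldots,z_N$ is $f(z)=\sum_{w\in\mathcal{F}_N}f_wz^w$, where $z^w=z_{i_1}\cdots z_{i_n}$ for $w=g_{i_1}\cdots g_{i_n}$; the indeterminates commute with coefficients and products are by convolution over factorizations of words. A scalar FPS is rational if it is obtained from non-commutative polynomials by finitely many sums, products and inversions (of FPSs with non-zero constant term); a matrix FPS is rational if all its entries are. GR-nodes. A GR-node $\alpha=(N;A,B,C,D;\mathbb{C}^r=\bigoplus_{k=1}^N\mathbb{C}^{r_k},\mathbb{C}^q)$ consists of matrices $A\in\mathbb{C}^{r\times r}$, $B\in\mathbb{C}^{r\times q}$, $C\in\mathbb{C}^{q\times r}$, $D\in\mathbb{C}^{q\times q}$, with blocks $A_{ij},B_i,C_j$ along the decomposition of $\mathbb{C}^r$. Its transfer function is the rational FPS $T^{\rm nc}_\alpha(z)=D+C(I_r-\Delta(z)A)^{-1}\Delta(z)B$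 with $\Delta(z)={\rm diag}(z_1I_{r_1},\ldots,z_NI_{r_N})$, i.e. the coefficient at $\emptyset$ is $D$ and at $w=g_{j_1}\cdots g_{j_n}$ it is $C_{j_1}A_{j_1j_2}\cdots A_{j_{n-1}j_n}B_{j_n}$. $\alpha$ is a GR-realization of $f$ if $T_\alpha^{\rm nc}=f$; it is minimal if each $r_k$ is the smallest possible among all GR-realizations of $f$. For minimal realizations one writes $\gamma_k$ for $r_k$ and $\gamma=\sum_k\gamma_k$. Unitary similarity. Two GR-nodes $\alpha^{(i)}=(N;A^{(i)},B^{(i)},C^{(i)},D;\mathbb{C}^\gamma=\bigoplus_k\mathbb{C}^{\gamma_k},\mathbb{C}^q)$, $i=1,2$, are unitarily similar if there is a block diagonal unitary $T={\rm diag}(T_1,\ldots,T_N)$, $T_k\in\mathbb{C}^{\gamma_k\times\gamma_k}$, with $A^{(1)}=T^{-1}A^{(2)}T$, $B^{(1)}=T^{-1}B^{(2)}$, $C^{(1)}=C^{(2)}T$. Evaluation. For $Z=(Z_1,\ldots,Z_N)\in(\mathbb{C}^{n\times n})^N$, $f(Z)$ is obtained by substituting $Z_k$ for $z_k$ in a rational expression for $f$; near $Z=0$ it equals $\sum_wf_w\otimes Z^w$, and it is a $\mathbb{C}^{q\times q}\otimes\mathbb{C}^{n\times n}$-valued rational function of the entries of the $Z_k$, defined (holomorphic) on an open dense set containing a neighbourhood of $0$. Matrix-$J$-unitarity and innerness. A signature matrix is $J$ with $J=J^*=J^{-1}$. Let $\mathbb{T}^{n\times n}$ be the set of unitary $n\times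 n$ matrices and $\mathcal{T}_N=\coprod_{n}(\mathbb{T}^{n\times n})^N$. $f$ is matrix-$J$-unitary on $\mathcal{T}_N$ if for every $n$, $f(W)(J\otimes I_n)f(W)^*=J\otimes I_n$ at all $W\in(\mathbb{T}^{n\times n})^N$ where $f(W)$ is defined. Let $\mathcal{D}_N=\coprod_n(\mathbb{D}^{n\times n})^N$ with $(\mathbb{D}^{n\times n})^N=\{W\in(\mathbb{C}^{n\times n})^N: W_kW_k^*<I_n\ \forall k\}$, whose closure is $\{W: W_kW_k^*\le I_n\ \forall k\}$. A matrix-$J$-unitary on $\mathcal{T}_N$ rational FPS $f$ is matrix-$J$-inner in $\mathcal{D}_N$ if for every $n\in\mathbb{N}$, $f(W)(J\otimes I_n)f(W)^*\le J\otimes I_n$ at those points $W\in{\rm clos}(\mathbb{D}^{n\times n})^N$ where $f(W)$ is defined. Associated structured Hermitian matrix. If $f$ is matrix-$J$-unitary on $\mathcal{T}_N$ and $\alpha$ is a minimal GR-realization of $f$, there is a unique invertible Hermitian matrix $H={\rm diag}(H_1,\ldots,H_N)$, $H_k\in\mathbb{C}^{\gamma_k\times\gamma_k}$, with $$\begin{pmatrix}A&B\\C&D\end{pmatrix}^*\begin{pmatrix}H&0\\0&J\end{pmatrix}\begin{pmatrix}A&B\\C&D\end{pmatrix}=\begin{pmatrix}H&0\\0&J\end{pmatrix};$$ it is called the structured Hermitian matrix associated with $\alpha$. *)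

(* Defs.v *)
From mathcomp Require Import all_boot all_order all_algebra.
From mathcomp Require Export reals.
From mathcomp.real_closed Require Export complex mxtens.

Set Implicit Arguments.
Unset Strict Implicit.
Unset Printing Implicit Defensive.

Import GRing.Theory Num.Theory.
Local Open Scope ring_scope.
Local Open Scope sesquilinear_scope.

Section Matrices.
Variable C : numClosedFieldType.

Definition signature_mx q (J : 'M[C]_q) : Prop :=
  J \is hermsymmx /\ J *m J = 1%:M.

(* [0 <= z] in C means that z is real and nonnegative, so lemx P Q forces
   Q - P to be Hermitian; this is the Loewner order P <= Q. *)
Definition lemx n (P Q : 'M[C]_n) : Prop :=
  forall x : 'cV[C]_n, 0 <= (x ^t* *m (Q - P) *m x) 0 0.

End Matrices.

Section FormalPowerSeries.
Variables (C : numClosedFieldType) (N : nat).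

Definition fps := seq 'I_N -> C.
Definition mxfps q := seq 'I_N -> 'M[C]_q.

Definition fps_const (c : C) : fps := fun w => if w is [::] then c else 0.
Definition fps_var (k : 'I_N) : fps := fun w => (w == [:: k])%:R.
Definition fps_add (f g : fps) : fps := fun w => f w + g w.
Definition fps_mul (f g : fps) : fps :=
  fun w => \sum_(i < (size w).+1) f (take i w) * g (drop i w).

Inductive rexpr : Type :=
| RConst of C
| RVar of 'I_N
| RAdd of rexpr & rexpr
| RMul of rexpr & rexpr
| RInv of rexpr.

Fixpoint rexpr_represents (e : rexpr) (f : fps) : Prop :=
  match e with
  | RConst c => f =1 fps_const c
  | RVar k => f =1 fps_var k
  | RAdd e1 e2 => exists f1 f2 : fps,
      [/\ rexpr_represents e1 f1, rexpr_represents e2 f2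
        & f =1 fps_add f1 f2]
  | RMul e1 e2 => exists f1 f2 : fps,
      [/\ rexpr_represents e1 f1, rexpr_represents e2 f2
        & f =1 fps_mul f1 f2]
  | RInv e1 => exists g : fps,
      [/\ rexpr_represents e1 g, g [::] != 0,
          fps_mul g f =1 fps_const 1 & fps_mul f g =1 fps_const 1]
  end.

(* None when some inversion occurring in the expression is impossible at Z. *)
Fixpoint rexpr_eval n (Z : 'I_N -> 'M[C]_n) (e : rexpr) : option 'M[C]_n :=
  match e with
  | RConst c => Some c%:M
  | RVar k => Some (Z k)
  | RAdd e1 e2 =>
      if (rexpr_eval Z e1, rexpr_eval Z e2) is (Some M1, Some M2)
      then Some (M1 + M2) else None
  | RMul e1 e2 =>
      if (rexpr_eval Z e1, rexpr_eval Z e2) is (Some M1, Some M2)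
      then Some (M1 *m M2) else None
  | RInv e1 =>
      if rexpr_eval Z e1 is Some M
      then if M \in unitmx then Some (invmx M) else None
      else None
  end.

Definition mxfps_rational q (f : mxfps q) : Prop :=
  forall i j, exists e, rexpr_represents e (fun w => f w i j).

(* f(Z) is defined and equals V, as an element of C^{q x q} (x) C^{n x n}:
   substituting Z in some rational expressions for the entries of f is possible
   and yields V. Different expressions for f give the same value wherever they
   are both defined, so V is determined by f and Z. *)
Definition mxfps_value q n (f : mxfps q) (Z : 'I_N -> 'M[C]_n)
    (V : 'M[C]_(q * n)) : Prop :=
  exists (E : 'I_q -> 'I_q -> rexpr) (v : 'I_q -> 'I_q -> 'M[C]_n),
    [/\ forall i j, rexpr_represents (E i j) (fun w => f w i j),
        forall i j, rexpr_eval Z (E i j) = Some (v i j)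
      & V = \sum_i \sum_j delta_mx i j *t v i j].

Definition matrix_J_unitary q (J : 'M[C]_q) (f : mxfps q) : Prop :=
  forall n (W : 'I_N -> 'M[C]_n) (V : 'M[C]_(q * n)),
    (forall k, W k \is unitarymx) -> mxfps_value f W V ->
    V *m (J *t 1%:M) *m V ^t* = J *t 1%:M.

Definition matrix_J_inner q (J : 'M[C]_q) (f : mxfps q) : Prop :=
  matrix_J_unitary J f /\
  forall n (W : 'I_N -> 'M[C]_n) (V : 'M[C]_(q * n)),
    (forall k, lemx (W k *m W k ^t*) 1%:M) -> mxfps_value f W V ->
    lemx (V *m (J *t 1%:M) *m V ^t*) (J *t 1%:M).

End FormalPowerSeries.

Section Realizations.
Variables (C : numClosedFieldType) (N q : nat).

Record GR_node (r : 'I_N -> nat) := GRNode {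
  GR_A : 'M[C]_(\sum_k r k);
  GR_B : 'M[C]_(\sum_k r k, q);
  GR_C : 'M[C]_(q, \sum_k r k);
  GR_D : 'M[C]_q }.

Section Node.
Variables (r : 'I_N -> nat) (alpha : GR_node r).

(* GR_tail [:: j_2; ..; j_n] j_1 = A_{j_1 j_2} ... A_{j_{n-1} j_n} B_{j_n} *)
Fixpoint GR_tail (w : seq 'I_N) (i : 'I_N) : 'M[C]_(r i, q) :=
  if w is j :: w' then submxblock (GR_A alpha) i j *m GR_tail w' j
  else submxcol (GR_B alpha) i.

(* The coefficients of D + C (I - Delta(z) A)^{-1} Delta(z) B. *)
Definition GR_transfer : mxfps C N q := fun w =>
  if w is j :: w' then submxrow (GR_C alpha) j *m GR_tail w' j
  else GR_D alpha.

Definition GR_realization (f : mxfps C N q) : Prop := GR_transfer =1 f.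

Definition structured_hermitian_of (J : 'M[C]_q) (H : 'M[C]_(\sum_k r k)) :=
  let U := block_mx (GR_A alpha) (GR_B alpha) (GR_C alpha) (GR_D alpha) in
  [/\ exists Hk : forall k, 'M[C]_(r k), H = \mxdiag_k Hk k,
      H \is hermsymmx,
      H \in unitmx
    & U ^t* *m block_mx H 0 0 J *m U = block_mx H 0 0 J].

End Node.

Definition GR_minimal_realization r (alpha : GR_node r) (f : mxfps C N q) :=
  GR_realization alpha f /\
  forall s (beta : GR_node s), GR_realization beta f ->
    forall k, (r k <= s k)%N.

Definition unitarily_similar r (alpha1 alpha2 : GR_node r) : Prop :=
  GR_D alpha1 = GR_D alpha2 /\
  exists2 Tk : forall k, 'M[C]_(r k), forall k, Tk k \is unitarymx &
    let T := \mxdiag_k Tk k in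
    [/\ GR_A alpha1 = invmx T *m GR_A alpha2 *m T,
        GR_B alpha1 = invmx T *m GR_B alpha2
      & GR_C alpha1 = GR_C alpha2 *m T].

End Realizations.

(* Main.v *)
Require Import Defs.
From mathcomp Require Import all_boot all_order all_algebra.
From mathcomp Require Import fingroup perm boolp ring.

(* Let U = [A B; C D] be the system matrix of a minimal GR-realization of f.
   Everything rests on finding a block diagonal G (the inverse of the paper's
   H) with U (G + J) U^H = G + J, where + is the direct sum and ^H the
   conjugate transpose.

   Put c(W) = C (I - Delta(W) A)^{-1}, x(W) = (I - Delta(W) A)^{-1} Delta(W) B
   and S(W) = x(W) J f(W)^H.  If G exists, then S(W) = G c(W)^H at unitary W,
   and conversely this identity, for all generic unitary W of all sizes, gives
   U (G + J) U^H = G + J by observability.  To produce G, note that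
   J-unitarity at W and W' makes
     J - f(W) J f(W')^H = c(W) (I - Delta(W) Delta(W')^H) S(W')
   symmetric under exchanging W, W' and taking adjoints.  When W' is a rank one
   unitary perturbation of the single matrix W_k along a vector a, the middle
   factor has rank one and the identity becomes
     gamma(W) sigma(W')^H = sigma(W) gamma(W')^H,
   gamma(W) = c_k(W) (I (x) a), sigma(W) = S_k(W)^H (I (x) a).  As soon as
   gamma(W') is injective this yields sigma(W) = gamma(W) G_k, and taking direct
   sums of tuples shows that G_k does not depend on W, a and the size.

   Contractive rank one perturbations give J - f(W') J f(W')^H =
   t gamma(W') G_k gamma(W')^H with t > 0, so innerness forces G >= 0;
   controllability makes G invertible, and a factorization G = T T^H with T block
   diagonal turns the given realization into one with H = I.  Uniqueness: the
   similarity T between two such realizations satisfies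
   (T^H T + I) U = U (T^H T + I), whence T^H T = I by controllability.

   The values f(W) are defined through rational expressions.  The points W that
   have to be avoided form a proper algebraic subset which does not contain any
   tuple of strictly upper triangular matrices; along an affine line, all but
   finitely many parameters are therefore allowed once one is, and the circle
   |t| = 1 supplies unitary points. *)

Set Implicit Arguments.
Unset Strict Implicit.
Unset Printing Implicit Defensive.

Import Order.TTheory GRing.Theory Num.Theory.
Local Open Scope ring_scope.
Local Open Scope sesquilinear_scope.

Arguments mxtens_unindex {m n}.

Lemma sum_mxtens (V : nmodType) m n (G : 'I_(m * n) -> V) :
  \sum_k G k = \sum_i \sum_j G (mxtens_index (i, j)).
Proof.
rewrite pair_bigA (reindex (@mxtens_index m n)) /=; last first.
  by exists mxtens_unindex => x _;
    [exact: mxtens_indexK | exact: mxtens_unindexK].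
by apply: eq_bigr => -[].
Qed.

(** * Kronecker products *)

Section Kronecker.
Variable F : comNzRingType.
Implicit Types m n p q r : nat.

Lemma tensmxDl m n p q (A B : 'M[F]_(m, n)) (X : 'M[F]_(p, q)) :
  (A + B) *t X = A *t X + B *t X.
Proof. by apply/matrixP => i j; rewrite !mxE mulrDl. Qed.

Lemma tensmxDr m n p q (A : 'M[F]_(m, n)) (X Y : 'M[F]_(p, q)) :
  A *t (X + Y) = A *t X + A *t Y.
Proof. by apply/matrixP => i j; rewrite !mxE mulrDr. Qed.

Lemma tensmxZl m n p q a (A : 'M[F]_(m, n)) (X : 'M[F]_(p, q)) :
  (a *: A) *t X = a *: (A *t X).
Proof. by apply/matrixP => i j; rewrite !mxE mulrA. Qed.

Lemma tensmxZr m n p q a (A : 'M[F]_(m, n)) (X : 'M[F]_(p, q)) :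
  A *t (a *: X) = a *: (A *t X).
Proof. by apply/matrixP => i j; rewrite !mxE mulrCA. Qed.

Lemma tensmxNl m n p q (A : 'M[F]_(m, n)) (X : 'M[F]_(p, q)) :
  (- A) *t X = - (A *t X).
Proof. by rewrite -scaleN1r tensmxZl scaleN1r. Qed.

Lemma tensmxNr m n p q (A : 'M[F]_(m, n)) (X : 'M[F]_(p, q)) :
  A *t (- X) = - (A *t X).
Proof. by rewrite -scaleN1r tensmxZr scaleN1r. Qed.

Lemma tensmxBl m n p q (A B : 'M[F]_(m, n)) (X : 'M[F]_(p, q)) :
  (A - B) *t X = A *t X - B *t X.
Proof. by rewrite tensmxDl tensmxNl. Qed.

Lemma tensmxBr m n p q (A : 'M[F]_(m, n)) (X Y : 'M[F]_(p, q)) :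
  A *t (X - Y) = A *t X - A *t Y.
Proof. by rewrite tensmxDr tensmxNr. Qed.

Lemma tensmx_suml m n p q (I : finType) (P : pred I) (A : I -> 'M[F]_(m, n))
    (X : 'M[F]_(p, q)) : (\sum_(i | P i) A i) *t X = \sum_(i | P i) A i *t X.
Proof.
by apply: (big_morph (fun A : 'M_(m, n) => A *t X)) => [A1 A2|];
  rewrite ?tensmxDl ?tens0mx.
Qed.

Lemma tensmx_sumr m n p q (I : finType) (P : pred I) (A : 'M[F]_(m, n))
    (X : I -> 'M[F]_(p, q)) :
  A *t (\sum_(i | P i) X i) = \sum_(i | P i) A *t X i.
Proof.
by apply: (big_morph (fun X : 'M_(p, q) => A *t X)) => [A1 A2|];
  rewrite ?tensmxDr ?tensmx0.
Qed.

Lemma tensmx11 m n : (1%:M : 'M[F]_m) *t (1%:M : 'M[F]_n) = 1%:M.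
Proof.
apply/matrixP => i j; rewrite -(mxtens_unindexK i) -(mxtens_unindexK j).
case: (mxtens_unindex i) => a b; case: (mxtens_unindex j) => c d.
rewrite tensmxE !mxE (can_eq (@mxtens_indexK _ _)) xpair_eqE.
by case: (a == c); case: (b == d); rewrite ?mulr1 ?mulr0.
Qed.

Lemma tensmx_eq0 m n p (A : 'M[F]_(m, n)) :
  (0 < p)%N -> A *t (1%:M : 'M[F]_p) = 0 -> A = 0.
Proof.
case: p => // p _ AX0; apply/matrixP => i j.
have /matrixP/(_ (mxtens_index (i, ord0)) (mxtens_index (j, ord0))) := AX0.
by rewrite tensmxE !mxE mulr1.
Qed.

(* [tcol r a] is [1 *t a] for a column [a], as a map of width [r] instead of
   [r * 1]. *)
Definition tcol r n (a : 'cV[F]_n) : 'M[F]_(r * n, r) :=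
  \matrix_(i, j) (((mxtens_unindex i).1 == j)%:R * a (mxtens_unindex i).2 0).

Definition trow r n (a : 'rV[F]_n) : 'M[F]_(r, r * n) := (tcol r a^T)^T.

Lemma tcolE r n (a : 'cV[F]_n) i j k :
  tcol r a (mxtens_index (i, j)) k = (i == k)%:R * a j 0.
Proof. by rewrite mxE mxtens_indexK. Qed.

Lemma tens_tcol r s n p (X : 'M[F]_(s, r)) (M : 'M[F]_(p, n)) (a : 'cV[F]_n) :
  (X *t M) *m tcol r a = tcol s (M *m a) *m X.
Proof.
apply/matrixP => i k; rewrite -(mxtens_unindexK i).
case: (mxtens_unindex i) => {}i j; rewrite !mxE.
rewrite sum_mxtens (bigD1 k) //= [X in _ + X]big1 ?addr0 => [|l /negPf lk];
  last first.
  by apply: big1 => l2 _; rewrite tcolE lk mul0r mulr0.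
rewrite [RHS](bigD1 i) //= [X in _ = _ + X]big1 ?addr0 => [|l /negPf lk];
  last first.
  by rewrite tcolE [i == l]eq_sym lk !mul0r.
rewrite tcolE eqxx !mul1r mxE mulr_suml; apply: eq_bigr => l _.
by rewrite tensmxE tcolE eqxx mul1r -mulrA mulrC.
Qed.

Lemma tens1_tcol r s n (X : 'M[F]_(s, r)) (a : 'cV[F]_n) :
  (X *t 1%:M) *m tcol r a = tcol s a *m X.
Proof. by rewrite tens_tcol mul1mx. Qed.

Lemma trow_tens r s n p (X : 'M[F]_(s, r)) (M : 'M[F]_(n, p)) (a : 'rV[F]_n) :
  trow s a *m (X *t M) = X *m trow r (a *m M).
Proof.
apply: trmx_inj; rewrite /trow [LHS]trmx_mul trmxK trmx_tens tens_tcol.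
by rewrite -trmx_mul [RHS]trmx_mul trmxK.
Qed.

Lemma trow_tens1 r s n (X : 'M[F]_(s, r)) (a : 'rV[F]_n) :
  trow s a *m (X *t 1%:M) = X *m trow r a.
Proof. by rewrite trow_tens mulmx1. Qed.

Lemma trow_tcol r n (b : 'rV[F]_n) (a : 'cV[F]_n) :
  trow r b *m tcol r a = ((b *m a) 0 0)%:M.
Proof.
apply/matrixP => i k; rewrite !mxE.
rewrite sum_mxtens (bigD1 i) //= [X in _ + X]big1 ?addr0 => [|l /negPf lk];
  last first.
  by apply: big1 => l2 _; rewrite mxE tcolE lk !mul0r.
rewrite -mulr_natr mulr_suml; apply: eq_bigr => l _.
by rewrite mxE !tcolE eqxx mxE mul1r [_%:R * _]mulrC mulrA.
Qed.

Lemma tcol_trow r n p (a : 'cV[F]_n) (b : 'rV[F]_p) :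
  tcol r a *m trow r b = 1%:M *t (a *m b).
Proof.
apply/matrixP => i k; rewrite -(mxtens_unindexK i) -(mxtens_unindexK k).
case: (mxtens_unindex i) => {}i j; case: (mxtens_unindex k) => {}k l.
rewrite tensmxE !mxE (bigD1 i) //= big1 ?addr0 => [|s /negPf si]; last first.
  by rewrite tcolE eq_sym si !mul0r.
rewrite big_ord1 tcolE [trow _ _ _ _]mxE tcolE [b^T _ _]mxE eqxx mul1r.
by rewrite [k == i]eq_sym mulrCA.
Qed.

Lemma tcol0 r n : tcol r (0 : 'cV[F]_n) = 0.
Proof. by apply/matrixP => i j; rewrite !mxE mulr0. Qed.

Lemma tcolZ r n c (a : 'cV[F]_n) : tcol r (c *: a) = c *: tcol r a.
Proof. by apply/matrixP => i j; rewrite !mxE mulrCA. Qed.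

Lemma sum_delta_cVrV n :
  \sum_j delta_mx j (0 : 'I_1) *m delta_mx 0 j = 1%:M :> 'M[F]_n.
Proof.
rewrite [RHS]matrix_sum_delta; apply: eq_bigr => i _.
rewrite (bigD1 i) //= big1 ?addr0 => [|j /negPf ji]; last first.
  by rewrite mxE eq_sym ji scale0r.
by rewrite mxE eqxx scale1r mul_delta_mx.
Qed.

Lemma eq_tcol p r n (M M' : 'M[F]_(p, r * n)) :
  (forall j, M *m tcol r (delta_mx j 0) = M' *m tcol r (delta_mx j 0)) ->
  M = M'.
Proof.
move=> MM'; rewrite -[M]mulmx1 -[M']mulmx1 -tensmx11 -(sum_delta_cVrV n).
rewrite tensmx_sumr !mulmx_sumr; apply: eq_bigr => j _.
by rewrite -tcol_trow !mulmxA MM'.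
Qed.

End Kronecker.

(** * Conjugate transposes *)

Section ConjugateTranspose.
Variable C : numClosedFieldType.

Lemma trmxC_mul m n p (A : 'M[C]_(m, n)) (B : 'M[C]_(n, p)) :
  (A *m B) ^t* = B ^t* *m A ^t*.
Proof. by rewrite trmx_mul map_mxM. Qed.

Lemma trmxC_tens m n p q (A : 'M[C]_(m, n)) (B : 'M[C]_(p, q)) :
  (A *t B) ^t* = A ^t* *t B ^t*.
Proof. by rewrite trmx_tens map_mxT. Qed.

Lemma trmxCD m n (A B : 'M[C]_(m, n)) : (A + B) ^t* = A ^t* + B ^t*.
Proof. by rewrite linearD map_mxD. Qed.

Lemma trmxCN m n (A : 'M[C]_(m, n)) : (- A) ^t* = - A ^t*.
Proof. by rewrite linearN map_mxN. Qed.

Lemma trmxCB m n (A B : 'M[C]_(m, n)) : (A - B) ^t* = A ^t* - B ^t*.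
Proof. by rewrite trmxCD trmxCN. Qed.

Lemma trmxCZ m n c (A : 'M[C]_(m, n)) : (c *: A) ^t* = c^* *: A ^t*.
Proof. by rewrite linearZ map_mxZ. Qed.

Lemma trmxC1 n : (1%:M : 'M[C]_n) ^t* = 1%:M.
Proof. by rewrite trmx1 map_mx1. Qed.

Lemma trmxC0 m n : (0 : 'M[C]_(m, n)) ^t* = 0.
Proof. by rewrite trmx0 map_mx0. Qed.

Lemma trmxC_sum m n (I : finType) (P : pred I) (A : I -> 'M[C]_(m, n)) :
  (\sum_(i | P i) A i) ^t* = \sum_(i | P i) (A i) ^t*.
Proof.
by apply: (big_morph (fun A : 'M_(m, n) => A ^t*)) => [A1 A2|];
  rewrite ?trmxCD ?trmxC0.
Qed.

Lemma trmxC_tcol r n (a : 'cV[C]_n) : (tcol r a) ^t* = trow r (a ^t*).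
Proof. by apply/matrixP => i j; rewrite !mxE rmorphM rmorph_nat. Qed.

Lemma hermsymmxP n (A : 'M[C]_n) : reflect (A ^t* = A) (A \is hermsymmx).
Proof.
rewrite qualifE /= expr0 scale1r; apply: (iffP eqP) => AE.
  by rewrite {1}AE trmxCK.
by rewrite AE.
Qed.

End ConjugateTranspose.

(** * Invertibility along affine lines and Schur complements *)

Section Generic.
Variable F : fieldType.

Lemma col_row_id m n : col_mx 1%:M 0 *m row_mx 1%:M 0 +
  col_mx 0 1%:M *m row_mx 0 1%:M = 1%:M :> 'M[F]_(m + n).
Proof.
rewrite !mul_col_row !mulmx0 !mul0mx !mulmx1 add_block_mx !addr0 add0r.
by rewrite -scalar_mx_block.
Qed.

Lemma row_inj_unitmx m (M : 'M[F]_m) :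
  (forall u : 'rV_m, u *m M = 0 -> u = 0) -> M \in unitmx.
Proof.
move=> injM; rewrite -row_free_unit -kermx_eq0.
apply/rowV0P => u /sub_kermxP; exact: injM.
Qed.

Lemma row_unitmx0 m n (M : 'M[F]_m) (u : 'M[F]_(n, m)) :
  M \in unitmx -> u *m M = 0 -> u = 0.
Proof. by move=> uM uM0; rewrite -[u](mulmxK uM) uM0 mul0mx. Qed.

Lemma det_affine m (M0 M1 : 'M[F]_m) :
  exists p : {poly F}, forall t, \det (M0 + t *: M1) = p.[t].
Proof.
exists (\det (map_mx polyC M0 + 'X *: map_mx polyC M1)) => t.
rewrite -[RHS]/(horner_eval t _) -det_map_mx; congr (\det _).
apply/matrixP => i j; rewrite !mxE.
by rewrite -[RHS]/((_ + _).[t]) hornerD hornerM hornerX !hornerC.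
Qed.

(** The determinant is a polynomial in [t], nonzero because its value at [t0] is. *)
Lemma unitmx_affine m (M0 M1 : 'M[F]_m) t0 :
  M0 + t0 *: M1 \in unitmx ->
  exists2 p : {poly F}, p != 0 & forall t, p.[t] != 0 -> M0 + t *: M1 \in unitmx.
Proof.
have [p pE] := det_affine M0 M1.
rewrite unitmxE unitfE pE => pt0; exists p => [|t].
  by apply: contraNneq pt0 => ->; rewrite horner0.
by rewrite unitmxE unitfE pE.
Qed.

(** Block elimination. It lets the nonvanishing of an expression containing a resolvent be read as
    the invertibility of a matrix that is affine in a parameter. *)
Lemma schur_unitmx m n (P : 'M[F]_m) (E : 'M[F]_(m, n)) (G : 'M[F]_(n, m))
    (H : 'M[F]_n) : P \in unitmx ->
  (block_mx P E G H \in unitmx) = (H - G *m invmx P *m E \in unitmx).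
Proof.
move=> uP.
have -> : block_mx P E G H = block_mx 1%:M 0 (G *m invmx P) 1%:M *m
    block_mx P E 0 (H - G *m invmx P *m E).
  rewrite mulmx_block !mul1mx !mul0mx !addr0 mulmxKV //.
  by rewrite [G *m _ *m E + _]addrC subrK.
rewrite unitmxE det_mulmx det_lblock det_ublock !det1 !mul1r unitrM.
by rewrite -!unitmxE uP.
Qed.

End Generic.

(** * Points of the unit circle and of (0, 1) avoiding the zeros of a polynomial *)

Section CirclePoint.
Variable C : numClosedFieldType.

Lemma exists_nonroot (p : {poly C}) (z : nat -> C) :
  injective z -> p != 0 -> exists m, p.[z m] != 0.
Proof.
move=> injz p0; apply: contrapT => nz.
have /(max_poly_roots p0) : all (root p) [seq z m | m <- iota 0 (size p)].
  apply/allP => _ /mapP[m _ ->]; apply/rootP/eqP; apply: contraT => pz.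
  by case: nz; exists m.
by rewrite map_inj_uniq ?iota_uniq // size_map size_iota ltnn => /(_ isT).
Qed.

Lemma circle_nonroot (p : {poly C}) :
  p != 0 -> exists s, [/\ s * s^* = 1, s != 1 & p.[s] != 0].
Proof.
(* Cayley transforms (m + i) / (m - i) of the natural numbers: of modulus one, pairwise distinct and
   never 1. *)
move=> p0; pose d m : C := m%:R - 'i; pose z m : C := (d m)^* / d m.
have dC m : (d m)^* = m%:R + 'i.
  by rewrite /d rmorphB /= rmorph_nat conjCi opprK.
have d0 m : d m != 0.
  rewrite subr_eq0; apply/eqP => /(congr1 (fun x => x ^+ 2)) /eqP.
  by rewrite sqrCi gt_eqF // (lt_le_trans (ltrN10 _)) // -natrX ler0n.
have dC0 m : (d m)^* != 0 by rewrite conjC_eq0.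
have i2 : 'i + 'i != 0 :> C by rewrite -mulr2n mulrn_eq0 /= neq0Ci.
have injz : injective z.
  move=> m m' /eqP; rewrite eqr_div // !dC /d => /eqP E.
  have : ('i + 'i) * (m'%:R - m%:R) = 0 :> C.
    have : (m%:R + 'i) * (m'%:R - 'i) - (m'%:R + 'i) * (m%:R - 'i) = 0 :> C.
      by rewrite E subrr.
    move=> <-; ring.
  by move/eqP; rewrite mulf_eq0 (negPf i2) /= subr_eq0 eqr_nat => /eqP ->.
have [m pz] := exists_nonroot injz p0.
exists (z m); split=> //.
  rewrite /z rmorphM /= fmorphV /= conjCK mulf_div [X in X / _]mulrC divff //.
  exact: mulf_neq0.
apply/eqP => /(congr1 (fun x => x * d m)).
rewrite mulfVK // mul1r dC => /eqP; rewrite -subr_eq0 /d.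
have -> : m%:R + 'i - (m%:R - 'i) = 'i + 'i :> C by ring.
by rewrite (negPf i2).
Qed.

Lemma unit_interval_nonroot (p : {poly C}) :
  p != 0 -> exists s, [/\ 0 < s, s < 1 & p.[s] != 0].
Proof.
move=> p0; pose z m : C := m.+2%:R^-1.
have injz : injective z.
  by move=> m m' /invr_inj/eqP; rewrite eqr_nat => /eqP[].
have [m pz] := exists_nonroot injz p0; exists (z m); split=> //.
  by rewrite invr_gt0 ltr0n.
by rewrite invf_lt1 ?ltr0n // ltr1n.
Qed.

End CirclePoint.

(** * Linear pencils and generic points *)

Section Pencil.
Variables (F : fieldType) (N : nat).

Definition tsum r s m n (X : 'I_N -> 'M[F]_(r, s)) (W : 'I_N -> 'M[F]_(m, n)) :
  'M[F]_(r * m, s * n) := \sum_k X k *t W k.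

Definition pencil r n (X : 'I_N -> 'M[F]_r) (W : 'I_N -> 'M[F]_n) :
  'M[F]_(r * n) := 1%:M - tsum X W.

Definition dsum m n (W1 : 'I_N -> 'M[F]_m) (W2 : 'I_N -> 'M[F]_n) :=
  fun k => block_mx (W1 k) 0 0 (W2 k).

Lemma tens_tsum r' m' r s m n (Y : 'M[F]_(r', r)) (V : 'M[F]_(m', m))
    (X : 'I_N -> 'M[F]_(r, s)) (W : 'I_N -> 'M[F]_(m, n)) :
  (Y *t V) *m tsum X W = tsum (fun k => Y *m X k) (fun k => V *m W k).
Proof. by rewrite mulmx_sumr; apply: eq_bigr => k _; rewrite tensmx_mul. Qed.

Lemma tsum_tens s' n' r s m n (Y : 'M[F]_(s, s')) (V : 'M[F]_(n, n'))
    (X : 'I_N -> 'M[F]_(r, s)) (W : 'I_N -> 'M[F]_(m, n)) :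
  tsum X W *m (Y *t V) = tsum (fun k => X k *m Y) (fun k => W k *m V).
Proof. by rewrite mulmx_suml; apply: eq_bigr => k _; rewrite tensmx_mul. Qed.

Lemma eq_tsum r s m n (X X' : 'I_N -> 'M[F]_(r, s))
    (W W' : 'I_N -> 'M[F]_(m, n)) :
  X =1 X' -> W =1 W' -> tsum X W = tsum X' W'.
Proof. by move=> XX' WW'; apply: eq_bigr => k _; rewrite XX' WW'. Qed.

Lemma tsum_tcol r s m n (X : 'I_N -> 'M[F]_(r, s)) (W : 'I_N -> 'M[F]_(m, n))
    (a : 'cV_n) : tsum X W *m tcol s a = \sum_k tcol r (W k *m a) *m X k.
Proof. by rewrite mulmx_suml; apply: eq_bigr => k _; rewrite tens_tcol. Qed.

Lemma tsum_affine r s m n (X : 'I_N -> 'M[F]_(r, s))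
    (Y Z : 'I_N -> 'M[F]_(m, n)) t :
  tsum X (fun k => Y k + t *: Z k) = tsum X Y + t *: tsum X Z.
Proof.
rewrite /tsum scaler_sumr -big_split /=; apply: eq_bigr => k _.
by rewrite tensmxDr tensmxZr.
Qed.

Lemma pencil_affine r n (X : 'I_N -> 'M[F]_r) (Y Z : 'I_N -> 'M[F]_n) t :
  pencil X (fun k => Y k + t *: Z k) = pencil X Y + t *: - tsum X Z.
Proof. by rewrite /pencil tsum_affine opprD addrA scalerN. Qed.

Lemma pencil_intertwine r m n (X : 'I_N -> 'M[F]_r) (W : 'I_N -> 'M[F]_m)
    (V : 'I_N -> 'M[F]_n) (M : 'M_(m, n)) :
  (forall k, W k *m M = M *m V k) ->
  pencil X W *m (1%:M *t M) = (1%:M *t M) *m pencil X V.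
Proof.
move=> WM; rewrite mulmxBl mulmxBr mul1mx mulmx1 tsum_tens tens_tsum.
by congr (_ - _); apply: eq_tsum => k; rewrite ?mulmx1 ?mul1mx.
Qed.

Lemma tcolD r n (a b : 'cV[F]_n) : tcol r (a + b) = tcol r a + tcol r b.
Proof. by apply/matrixP => i j; rewrite !mxE mulrDr. Qed.

Lemma tcol_sum_delta r n (a : 'cV[F]_n) :
  tcol r a = \sum_i a i 0 *: tcol r (delta_mx i 0).
Proof.
rewrite {1}[a]matrix_sum_delta.
rewrite (big_morph (fun b : 'cV_n => tcol r b) (id1 := 0) (op1 := +%R));
  last first.
- exact: tcol0.
- exact: tcolD.
by apply: eq_bigr => i _; rewrite big_ord1 tcolZ.
Qed.

Lemma row_tcol0 r n (u : 'rV[F]_(r * n)) :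
  (forall j, u *m tcol r (delta_mx j 0) = 0) -> u = 0.
Proof. by move=> u0; apply: eq_tcol => j; rewrite u0 mul0mx. Qed.

Definition strict_upper n (W : 'M[F]_n) :=
  forall i j : 'I_n, (j <= i)%N -> W i j = 0.

(** For a left null vector u, [u *m tcol r e_j] is built from the [u *m tcol r e_i] with i < j,
    because W_k e_j involves only such e_i; induction on j gives u = 0. *)
Lemma pencil_strict_upper_unit r n (X : 'I_N -> 'M[F]_r)
    (W : 'I_N -> 'M[F]_n) :
  (forall k, strict_upper (W k)) -> pencil X W \in unitmx.
Proof.
move=> Wup; apply: row_inj_unitmx => u /eqP.
rewrite mulmxBr mulmx1 subr_eq0 => /eqP uX; apply: row_tcol0 => j.
have [m] := ubnP (nat_of_ord j); elim: m => // m IHm in j *.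
rewrite ltnS => lt_jm; rewrite uX -mulmxA tsum_tcol mulmx_sumr big1 // => k _.
rewrite mulmxA tcol_sum_delta mulmx_sumr mulmx_suml big1 // => i _.
rewrite -colE mxE -scalemxAr; have [lt_ij | le_ji] := ltnP i j.
  by rewrite IHm ?scaler0 ?mul0mx // (leq_trans lt_ij).
by rewrite Wup // scale0r mul0mx.
Qed.

Definition tuple_pred := forall n, ('I_N -> 'M[F]_n) -> Prop.

(* [Q] holds off a proper algebraic subset, and at the nilpotent points where
   FPS coefficients can be read off. *)
Record regular (Q : tuple_pred) : Prop := Regular {
  regular_strict_upper : forall n (W : 'I_N -> 'M[F]_n),
    (forall k, strict_upper (W k)) -> Q n W;
  regular_dsum : forall m n (W1 : 'I_N -> 'M[F]_m) (W2 : 'I_N -> 'M[F]_n),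
    Q m W1 -> Q n W2 -> Q (m + n)%N (dsum W1 W2);
  regular_affine : forall n (Y Z : 'I_N -> 'M[F]_n) t0,
    Q n (fun k => Y k + t0 *: Z k) ->
    exists2 p : {poly F}, p != 0 &
      forall t, p.[t] != 0 -> Q n (fun k => Y k + t *: Z k) }.

Lemma regularI (Q1 Q2 : tuple_pred) :
  regular Q1 -> regular Q2 -> regular (fun n W => Q1 n W /\ Q2 n W).
Proof.
move=> [up1 ds1 af1] [up2 ds2 af2]; split.
- by move=> n W Wup; split; [apply: up1 | apply: up2].
- by move=> m n W1 W2 [? ?] [? ?]; split; [apply: ds1 | apply: ds2].
move=> n Y Z t0 [/af1[p1 p1n0 Q1p] /af2[p2 p2n0 Q2p]].
exists (p1 * p2) => [|t]; first exact: mulf_neq0.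
by rewrite hornerM mulf_eq0 => /norP[/Q1p ? /Q2p ?].
Qed.

Lemma regular_forall (I : finType) (Q : I -> tuple_pred) :
  (forall i, regular (Q i)) -> regular (fun n W => forall i, Q i n W).
Proof.
move=> regQ; split.
- by move=> n W Wup i; apply: regular_strict_upper (regQ i) _ _ Wup.
- by move=> m n W1 W2 Q1 Q2 i; apply: (regular_dsum (regQ i)).
move=> n Y Z t0 Qt0.
have /fin_all_exists2[p p0 pQ] : forall i, exists2 p : {poly F}, p != 0 &
    forall t, p.[t] != 0 -> Q i n (fun k => Y k + t *: Z k).
  by move=> i; apply: regular_affine (regQ i) _ _ _ _ (Qt0 i).
exists (\prod_i p i) => [|t]; first by apply/prodf_neq0 => i _.
by rewrite horner_prod => /prodf_neq0 pt i; apply: pQ; apply: pt.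
Qed.

Lemma dsum_pid1 m n (W1 : 'I_N -> 'M[F]_m) (W2 : 'I_N -> 'M[F]_n) k :
  dsum W1 W2 k *m col_mx 1%:M 0 = col_mx 1%:M 0 *m W1 k.
Proof.
by rewrite mul_block_col mul_col_mx !mulmx0 !mulmx1 !mul0mx mul1mx !addr0.
Qed.

Lemma dsum_pid2 m n (W1 : 'I_N -> 'M[F]_m) (W2 : 'I_N -> 'M[F]_n) k :
  dsum W1 W2 k *m col_mx 0 1%:M = col_mx 0 1%:M *m W2 k.
Proof.
by rewrite mul_block_col mul_col_mx !mulmx0 !mulmx1 !mul0mx mul1mx !add0r.
Qed.

(** A left null vector at a direct sum splits into null vectors of the pencils of the two summands;
    along a line the determinant is a polynomial. *)
Lemma regular_pencil r (X : 'I_N -> 'M[F]_r) :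
  regular (fun n W => pencil X W \in unitmx).
Proof.
split.
- by move=> n W; apply: pencil_strict_upper_unit.
- move=> m n W1 W2 u1 u2; apply: row_inj_unitmx => u uW0.
  have uj1 : u *m (1%:M *t col_mx 1%:M 0) = 0 :> 'rV_(r * m).
    apply: (row_unitmx0 u1); rewrite -mulmxA.
    by rewrite -(pencil_intertwine _ (dsum_pid1 W1 W2)) mulmxA uW0 mul0mx.
  have uj2 : u *m (1%:M *t col_mx 0 1%:M) = 0 :> 'rV_(r * n).
    apply: (row_unitmx0 u2); rewrite -mulmxA.
    by rewrite -(pencil_intertwine _ (dsum_pid2 W1 W2)) mulmxA uW0 mul0mx.
  rewrite -[u]mulmx1 -tensmx11.
  rewrite -col_row_id tensmxDr mulmxDr.
  have tE p (M : 'M[F]_(m + n, p)) (M' : 'M[F]_(p, m + n)) :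
      1%:M *t (M *m M') = (1%:M *t M) *m (1%:M *t M') :> 'M_(r * _).
    by rewrite tensmx_mul mulmx1.
  by rewrite !tE !mulmxA uj1 uj2 !mul0mx addr0.
move=> n Y Z t0; rewrite pencil_affine => /unitmx_affine[p p0 pU].
by exists p => // t /pU; rewrite pencil_affine.
Qed.

End Pencil.

(** * Generic unitary points and detection of nonzero coefficients *)

Section Path.
Variables (C : numClosedFieldType) (N : nat).

(** Each condition excludes only zeros of a nonzero polynomial, so one admissible [t0] anywhere
    supplies parameters on the circle. The value 1 is avoided because the perturbations [pert] below
    are trivial there. *)
Lemma regular_circle (Q : tuple_pred C N) n (Y Z : 'I_N -> 'M[C]_n) m
    (M0 M1 : 'M[C]_m) t0 :
    regular Q -> Q n (fun k => Y k + t0 *: Z k) -> M0 + t0 *: M1 \in unitmx ->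
  exists t, [/\ t * t^* = 1, t != 1, Q n (fun k => Y k + t *: Z k)
    & M0 + t *: M1 \in unitmx].
Proof.
move=> regQ /(regular_affine regQ)[p p0 pQ] /unitmx_affine[p' p'0 p'U].
have [t [t1 tn1 pt]] := circle_nonroot (mulf_neq0 p0 p'0).
by exists t; move: pt; rewrite hornerM mulf_eq0 => /norP[/pQ ? /p'U ?].
Qed.

Lemma regular_interval (Q : tuple_pred C N) n (Y Z : 'I_N -> 'M[C]_n) m
    (M0 M1 : 'M[C]_m) t0 :
    regular Q -> Q n (fun k => Y k + t0 *: Z k) -> M0 + t0 *: M1 \in unitmx ->
  exists t, [/\ 0 < t, t < 1, Q n (fun k => Y k + t *: Z k)
    & M0 + t *: M1 \in unitmx].
Proof.
move=> regQ /(regular_affine regQ)[p p0 pQ] /unitmx_affine[p' p'0 p'U].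
have [t [t1 tn1 pt]] := unit_interval_nonroot (mulf_neq0 p0 p'0).
by exists t; move: pt; rewrite hornerM mulf_eq0 => /norP[/pQ ? /p'U ?].
Qed.

Lemma unitmx11 (x : 'M[C]_1) : (x \in unitmx) = (x != 0).
Proof.
rewrite unitmxE det_mx11 unitfE; congr (~~ _).
apply/eqP/eqP => [x0|->]; last by rewrite mxE.
by apply/matrixP => i j; rewrite !ord1 x0 mxE.
Qed.

Lemma diag_mx_unitary n (d : 'rV[C]_n) :
  (forall i, d 0 i * (d 0 i)^* = 1) -> diag_mx d \is unitarymx.
Proof.
move=> d1; apply/unitarymxP; rewrite tr_diag_mx map_diag_mx mulmx_diag.
by rewrite -diag_const_mx; congr diag_mx; apply/rowP => i; rewrite !mxE d1.
Qed.

Lemma perm_mx_unitary n (s : 'S_n) : (perm_mx s : 'M[C]_n) \is unitarymx.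
Proof.
apply/unitarymxP; rewrite tr_perm_mx map_perm_mx -perm_mxM.
by rewrite mulgV perm_mx1.
Qed.

Section Shift.
Variables (m : nat) (u : seq 'I_N) (k0 : 'I_N).
Let n := m.+2.
Let s : 'S_n := perm (@ordS_inj n).
Let cond (j : 'I_N) : 'rV[C]_n :=
  \row_(b < n) ((b != 0) && (nth k0 u b.-1 == j))%:R.

(* [weighted_shift j] maps e_{i+1} to e_i when the i-th letter of [u] is [j] and
   to 0 otherwise; [coweighted_shift j] consists of the arrows of the cyclic
   shift that are missing. *)
Definition weighted_shift (j : 'I_N) : 'M[C]_n := perm_mx s *m diag_mx (cond j).
Definition coweighted_shift (j : 'I_N) : 'M[C]_n :=
  perm_mx s *m diag_mx (const_mx 1 - cond j).

(** The sum is a cyclic permutation matrix times a diagonal matrix with entries 1 and [t]. *)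
Lemma shift_unitary t j : t * t^* = 1 ->
  weighted_shift j + t *: coweighted_shift j \is unitarymx.
Proof.
move=> t1; rewrite /weighted_shift /coweighted_shift scalemxAr -mulmxDr.
apply: mul_unitarymx; first exact: perm_mx_unitary.
have -> : diag_mx (cond j) + t *: diag_mx (const_mx 1 - cond j) =
    diag_mx (cond j + t *: (const_mx 1 - cond j)).
  by rewrite -linearZ -linearD.
apply: diag_mx_unitary => i; rewrite !mxE; case: (_ && _).
  by rewrite subrr mulr0 addr0 mulr1n rmorph1 mulr1.
by rewrite subr0 mulr1 add0r.
Qed.

Lemma weighted_shiftE j a b : weighted_shift j a b =
  ((a.+1 == b) && (nth k0 u a == j))%:R.
Proof.
rewrite /weighted_shift mul_mx_diag !mxE permE -val_eqE /= -natrM mulnb.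
congr (nat_of_bool _)%:R; have [lt_an | ] := ltnP a.+1 n.
  rewrite modn_small //.
  by case: eqP => //= ab; rewrite -val_eqE /= -ab.
(* The last row is the wrap-around of the cycle: it points to column 0, where [cond] vanishes. *)
rewrite leq_eqVlt ltnNge ltn_ord /= orbF => /eqP an.
rewrite -an modnn eq_sym -val_eqE /=.
by rewrite andbA andbN (gtn_eqF (ltn_ord b)).
Qed.

Lemma weighted_shift_strict_upper j : strict_upper (weighted_shift j).
Proof.
by move=> a b le_ba; rewrite weighted_shiftE gtn_eqF // ltnS.
Qed.

Lemma weighted_shift_delta j i : (i < m.+1)%N ->
  weighted_shift j *m delta_mx (inord i.+1) 0 =
  (nth k0 u i == j)%:R *: delta_mx (inord i) 0 :> 'cV_n.
Proof.
move=> lt_im; rewrite -colE; apply/colP => a.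
rewrite mxE weighted_shiftE inordK // !mxE eqSS eqxx andbT -natrM mulnb andbC.
rewrite -[a == inord i]val_eqE /= inordK 1?ltnW //.
by case: (nat_of_ord a =P i) => [->|]; rewrite ?andbF.
Qed.

End Shift.

Definition mxword r (X : 'I_N -> 'M[C]_r) (w : seq 'I_N) : 'M[C]_r :=
  foldr (fun j M => X j *m M) 1%:M w.

Lemma mxword_rcons r (X : 'I_N -> 'M[C]_r) w j :
  mxword X (rcons w j) = mxword X w *m X j.
Proof. by elim: w => /= [|i w ->]; rewrite ?mulmx1 ?mul1mx ?mulmxA. Qed.

(* The last quantity is a rational function of the parameter [t] of the shifts
   above; at [t = 0] it equals the coefficient in the hypothesis, hence it does
   not vanish at some [t] on the unit circle.  Passing to a Schur complement
   makes its nonvanishing the invertibility of a matrix affine in [t]. *)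
Lemma regular_detect (Q : tuple_pred C N) r p (X : 'I_N -> 'M[C]_r)
    (Y : 'I_N -> 'M[C]_(r, p)) (l : 'rV_r) (v : 'cV_p) w k :
    regular Q -> l *m mxword X w *m Y k *m v != 0 ->
  exists n (W : 'I_N -> 'M[C]_n) (a : 'cV_n) (b : 'rV_n),
    [/\ forall j, W j \is unitarymx, Q n W, b *m a = 0, pencil X W \in unitmx &
      l *m trow r b *m invmx (pencil X W) *m tsum Y W *m tcol p a *m v != 0].
Proof.
move=> regQ nz; pose m := size w; pose u := rcons w k; pose n := m.+2.
pose W0 := weighted_shift m u k; pose W1 := coweighted_shift m u k.
pose e i : 'cV[C]_n := delta_mx (inord i) 0; pose b : 'rV[C]_n := delta_mx 0 0.
have W0e j i : (i < m.+1)%N -> W0 j *m e i.+1 = (nth k u i == j)%:R *: e i.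
  exact: weighted_shift_delta.
pose M0 := block_mx (pencil X W0) (tsum Y W0 *m tcol p (e m.+1) *m v)
  (- (l *m trow r b)) 0.
pose M1 := block_mx (- tsum X W1) (tsum Y W1 *m tcol p (e m.+1) *m v)
  (0 : 'rV_(r * n)) (0 : 'M_1).
have uP0 : pencil X W0 \in unitmx.
  by apply: pencil_strict_upper_unit => j; apply: weighted_shift_strict_upper.
have [psi psiE] : {psi | psi = l *m trow r b *m invmx (pencil X W0)}.
  by eexists.
have psiP : psi = psi *m tsum X W0 + l *m trow r b.
  by rewrite -[l *m _](mulmxKV uP0) -psiE mulmxBr mulmx1 addrC subrK.
(* The start is b e_0 = 1. For i > 0, b e_i = 0 and W0 sends e_i to e_{i-1} only for the letter in
   position i - 1, so each step appends one factor [X]. *)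
have psie i : (i <= m)%N -> psi *m tcol r (e i) = l *m mxword X (take i w).
  elim: i => [_|i IHi lt_im].
    have W00 j : W0 j *m e 0 = 0.
      rewrite -colE; apply/colP => a; rewrite mxE [RHS]mxE.
      by apply: weighted_shift_strict_upper; rewrite inordK.
    rewrite psiP mulmxDl -!mulmxA tsum_tcol trow_tcol take0 /= mulmx1.
    rewrite big1 => [|j _]; last by rewrite W00 tcol0 mul0mx.
    have e0 : inord 0 = 0 :> 'I_n by apply: val_inj; rewrite /= inordK.
    by rewrite mulmx0 add0r /e e0 mul_delta_mx mxE eqxx mulmx1.
  rewrite psiP mulmxDl -!mulmxA tsum_tcol trow_tcol.
  rewrite (bigD1 (nth k u i)) //= big1 ?addr0 => [|j /negPf ij]; last first.
    by rewrite W0e 1?ltnW // eq_sym ij scale0r tcol0 mul0mx.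
  rewrite W0e 1?ltnW // eqxx scale1r mulmxA IHi 1?ltnW //.
  rewrite /b /e mul_delta_mx_cond -val_eqE /= inordK ?ltnS 1?ltnW //= mulr0n.
  rewrite mxE raddf0 mulmx0 addr0.
  by rewrite (take_nth k) // mxword_rcons mulmxA nth_rcons lt_im.
(* At t = 0 the Schur complement is [psi *m tcol r (e m) *m Y k *m v], which is the coefficient
   assumed to be nonzero. *)
have uM0 : M0 + 0 *: M1 \in unitmx.
  rewrite scale0r addr0 schur_unitmx // unitmx11 sub0r mulNmx mulNmx opprK.
  rewrite !mulmxA -psiE.
  rewrite -[psi *m _ *m _]mulmxA tsum_tcol mulmx_sumr mulmx_suml.
  rewrite (bigD1 k) //= big1 ?addr0 => [|j /negPf jk]; last first.
    by rewrite W0e // nth_rcons ltnn eqxx eq_sym jk scale0r tcol0 mul0mx mulmx0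
      mul0mx.
  by rewrite W0e // nth_rcons ltnn eqxx eqxx scale1r mulmxA psie // take_size.
have Q0 : Q n (fun j => W0 j + 0 *: W1 j).
  apply: (regular_strict_upper regQ) => j; rewrite scale0r addr0.
  exact: weighted_shift_strict_upper.
pose QP n (W : 'I_N -> 'M[C]_n) := Q n W /\ pencil X W \in unitmx.
have regQP : regular QP by apply: regularI => //; apply: regular_pencil.
have QP0 : QP n (fun j => W0 j + 0 *: W1 j).
  by split=> //; rewrite pencil_affine scale0r addr0.
have [t [t1 _ [Qt uPt] uMt]] := regular_circle regQP QP0 uM0.
(* The two vectors are opposite ends of the chain, whence b a = 0; [obs_inj] uses this to remove a
   constant term. *)
exists n, (fun j => W0 j + t *: W1 j), (e m.+1), b; split=> //.
- by move=> j; apply: shift_unitary.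
- rewrite /b /e mul_delta_mx_cond -val_eqE /= inordK // mulr0n //.
move: uMt; suff <- : block_mx (pencil X (fun j => W0 j + t *: W1 j))
    (tsum Y (fun j => W0 j + t *: W1 j) *m tcol p (e m.+1) *m v)
    (- (l *m trow r b)) 0 = M0 + t *: M1.
  by rewrite schur_unitmx // unitmx11 sub0r !mulNmx opprK !mulmxA.
rewrite scale_block_mx add_block_mx pencil_affine tsum_affine !scaler0 !addr0.
by rewrite !mulmxDl -!scalemxAl.
Qed.

End Path.

(** * J-unitary system matrices *)

(* [Pi k] is the projection onto the [k]-th summand of the state space. *)
Section Colligation.
Variables (C : numClosedFieldType) (N r q : nat).
Variables (Pi : 'I_N -> 'M[C]_r) (A : 'M[C]_r) (B : 'M[C]_(r, q)).
Variables (K : 'M[C]_(q, r)) (D J : 'M[C]_q).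
Hypothesis PiC : forall k, (Pi k) ^t* = Pi k.
Hypothesis PiM : forall j k, Pi j *m Pi k = (j == k)%:R *: Pi k.
Hypothesis Pi1 : \sum_k Pi k = 1%:M.

Let X k := Pi k *m A.
(* Products are locked, otherwise rewriting with [mulmxA] unfolds them. *)
Definition Delta n (W : 'I_N -> 'M[C]_n) := tsum Pi W.
Definition obs n (W : 'I_N -> 'M[C]_n) :=
  locked ((K *t 1%:M) *m invmx (pencil X W)).
Definition ctr n (W : 'I_N -> 'M[C]_n) :=
  locked (invmx (pencil X W) *m Delta W *m (B *t 1%:M)).
Definition trf n (W : 'I_N -> 'M[C]_n) :=
  locked (D *t 1%:M + obs W *m Delta W *m (B *t 1%:M)).

Lemma PiK k : Pi k *m Pi k = Pi k.
Proof. by rewrite PiM eqxx scale1r. Qed.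

Lemma tsumX n (W : 'I_N -> 'M[C]_n) : tsum X W = Delta W *m (A *t 1%:M).
Proof. by rewrite tsum_tens; apply: eq_tsum => k; rewrite ?mulmx1. Qed.

Lemma DeltaM n (W V : 'I_N -> 'M[C]_n) :
  Delta W *m Delta V = Delta (fun k => W k *m V k).
Proof.
rewrite mulmx_suml; apply: eq_bigr => j _.
rewrite mulmx_sumr (bigD1 j) //= big1 => [|k kj].
  by rewrite tensmx_mul PiK addr0.
by rewrite tensmx_mul PiM eq_sym (negPf kj) scale0r tens0mx.
Qed.

Lemma DeltaC n (W : 'I_N -> 'M[C]_n) :
  (Delta W) ^t* = Delta (fun k => (W k) ^t*).
Proof.
by rewrite trmxC_sum; apply: eq_bigr => k _; rewrite trmxC_tens PiC.
Qed.

Lemma Delta1 n : Delta (fun _ => 1%:M : 'M[C]_n) = 1%:M.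
Proof. by rewrite /Delta /tsum -tensmx_suml Pi1 tensmx11. Qed.

Lemma Delta_unitaryl n (W : 'I_N -> 'M[C]_n) :
  (forall k, W k \is unitarymx) -> Delta W *m (Delta W) ^t* = 1%:M.
Proof.
move=> Wu; rewrite DeltaC DeltaM -Delta1; apply: eq_tsum => // k.
exact/unitarymxP.
Qed.

Lemma Delta_unitaryr n (W : 'I_N -> 'M[C]_n) :
  (forall k, W k \is unitarymx) -> (Delta W) ^t* *m Delta W = 1%:M.
Proof. by move=> /Delta_unitaryl/mulmx1C. Qed.

Lemma Delta_comm n (W : 'I_N -> 'M[C]_n) G :
  (forall k, Pi k *m G = G *m Pi k) ->
  Delta W *m (G *t 1%:M) = (G *t 1%:M) *m Delta W.
Proof.
by move=> PiG; rewrite tsum_tens tens_tsum; apply: eq_tsum => k;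
  rewrite ?mulmx1 ?mul1mx.
Qed.

Section Point.
Variables (n : nat) (W : 'I_N -> 'M[C]_n).
Hypothesis uW : pencil X W \in unitmx.

Lemma obsE : obs W = K *t 1%:M + obs W *m Delta W *m (A *t 1%:M).
Proof.
have : obs W *m pencil X W = K *t 1%:M by rewrite /obs -lock mulmxKV.
by rewrite mulmxBr mulmx1 tsumX mulmxA => <-; rewrite subrK.
Qed.

Lemma ctrE : ctr W = Delta W *m ((A *t 1%:M) *m ctr W + B *t 1%:M).
Proof.
have : pencil X W *m ctr W = Delta W *m (B *t 1%:M).
  by rewrite /ctr -lock -mulmxA mulKVmx.
rewrite mulmxBl mul1mx tsumX -mulmxA => /eqP.
by rewrite subr_eq addrC -mulmxDr => /eqP.
Qed.

Lemma trfE : trf W = D *t 1%:M + (K *t 1%:M) *m ctr W.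
Proof. by rewrite /trf /obs /ctr -!lock !mulmxA. Qed.

End Point.

(** A resolvent identity: [obsE] at W eliminates [K], and [ctrE] at W' collects the terms with
    Delta(W'). *)
Lemma trf_sub n (W W' : 'I_N -> 'M[C]_n) :
    pencil X W \in unitmx -> pencil X W' \in unitmx ->
  trf W - trf W' =
  obs W *m (Delta W - Delta W') *m ((A *t 1%:M) *m ctr W' + B *t 1%:M).
Proof.
move=> uW uW'; rewrite (trfE W') {1}/trf -lock opprD addrACA subrr add0r.
have KE : K *t 1%:M = obs W - obs W *m Delta W *m (A *t 1%:M).
  by rewrite {1}(obsE uW) addrK.
rewrite KE [in RHS]mulmxBr [RHS]mulmxBl -[obs W *m Delta W' *m _]mulmxA.
rewrite -(ctrE uW') [in LHS]mulmxBl [in RHS]mulmxDr !mulmxA opprB addrA.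
by rewrite [X in X - _]addrC.
Qed.

Section Intertwine.
Variables (m n : nat) (W : 'I_N -> 'M[C]_n) (V : 'I_N -> 'M[C]_m).
Variable L : 'M[C]_(m, n).
Hypotheses (uW : pencil X W \in unitmx) (uV : pencil X V \in unitmx).
Hypothesis LW : forall k, V k *m L = L *m W k.

(** An intertwining of tuples passes to the resolvents, hence to c, x and f below; it is used for
    the coordinate projections of a direct sum. *)
Lemma invmx_pencil_intertwine :
  (1%:M *t L) *m invmx (pencil X W) = invmx (pencil X V) *m (1%:M *t L).
Proof.
by apply: (canRL (mulKmx uV)); rewrite mulmxA (pencil_intertwine _ LW) mulmxK.
Qed.

Lemma Delta_intertwine : (1%:M *t L) *m Delta W = Delta V *m (1%:M *t L).
Proof.
by rewrite tsum_tens tens_tsum; apply: eq_tsum => k; rewrite ?mulmx1 ?mul1mx.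
Qed.

Lemma tens_comm s t (M : 'M[C]_(s, t)) :
  (1%:M *t L) *m (M *t 1%:M) = (M *t 1%:M) *m (1%:M *t L).
Proof. by rewrite !tensmx_mul !mul1mx !mulmx1. Qed.

Lemma obs_intertwine : (1%:M *t L) *m obs W = obs V *m (1%:M *t L).
Proof.
by rewrite /obs -!lock mulmxA tens_comm -mulmxA invmx_pencil_intertwine mulmxA.
Qed.

Lemma ctr_intertwine : (1%:M *t L) *m ctr W = ctr V *m (1%:M *t L).
Proof.
rewrite /ctr -!lock !mulmxA invmx_pencil_intertwine -[_ *m _ *m Delta W]mulmxA.
by rewrite Delta_intertwine -!mulmxA tens_comm.
Qed.

Lemma trf_intertwine : (1%:M *t L) *m trf W = trf V *m (1%:M *t L).
Proof.
rewrite !trfE mulmxDr mulmxDl mulmxA !tens_comm.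
by rewrite -[K *t _ *m _ *m ctr W]mulmxA ctr_intertwine mulmxA.
Qed.

End Intertwine.

Definition JJ n : 'M[C]_(q * n) := J *t 1%:M.
(** This is S(W), while [obs], [ctr] and [trf] are c(W), x(W) and f(W). *)
Definition scat n (W : 'I_N -> 'M[C]_n) :=
  locked (ctr W *m JJ n *m (trf W) ^t*).

(** * The Hermitian matrix attached to a J-unitary system *)

Section JUnitary.
Hypothesis JC : J ^t* = J.
Hypothesis J2 : J *m J = 1%:M.
Variable Q : tuple_pred C N.
Arguments Q {n}.
Hypothesis regQ : regular (@Q).
Hypothesis QP : forall n (W : 'I_N -> 'M[C]_n), Q W -> pencil X W \in unitmx.
Hypothesis trfJ : forall n (W : 'I_N -> 'M[C]_n), (forall k, W k \is unitarymx) ->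
  Q W -> trf W *m JJ n *m (trf W) ^t* = JJ n.
Hypothesis Kobs : forall k (v : 'cV_r),
  (forall w, K *m mxword X w *m Pi k *m v = 0) -> Pi k *m v = 0.

Definition good n (W : 'I_N -> 'M[C]_n) :=
  (forall k, W k \is unitarymx) /\ Q W.

Lemma JJC n : (JJ n) ^t* = JJ n.
Proof. by rewrite trmxC_tens JC trmxC1. Qed.

Lemma JJ2 n : JJ n *m JJ n = 1%:M.
Proof. by rewrite tensmx_mul J2 mulmx1 tensmx11. Qed.

(** With J replaced by f(W') J f(W')^H, [trf_sub] applies to f(W) - f(W'); unitarity of W' turns A
    x(W') + B into Delta(W')^H x(W'). *)
Lemma trf_scat n (W W' : 'I_N -> 'M[C]_n) : Q W -> good W' ->
  JJ n - trf W *m JJ n *m (trf W') ^t* =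
  obs W *m (1%:M - Delta W *m (Delta W') ^t*) *m scat W'.
Proof.
move=> QW [uW' QW']; rewrite -{1}(trfJ uW' QW') -!mulmxBl -[trf W' - _]opprB.
rewrite trf_sub ?QP //.
have -> : (A *t 1%:M) *m ctr W' + B *t 1%:M = (Delta W') ^t* *m ctr W'.
  rewrite [in RHS](ctrE (QP QW')).
  by rewrite [RHS]mulmxA Delta_unitaryr // mul1mx.
have -> : 1%:M - Delta W *m (Delta W') ^t* =
    - ((Delta W - Delta W') *m (Delta W') ^t*).
  by rewrite mulmxBl Delta_unitaryl // opprB.
by rewrite /scat -!lock mulmxN !mulNmx !mulmxA.
Qed.

(** Taking adjoints exchanges W and W' in J - f(W) J f(W')^H. *)
Lemma scat_sym n (W W' : 'I_N -> 'M[C]_n) : good W -> good W' ->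
  obs W *m (1%:M - Delta W *m (Delta W') ^t*) *m scat W' =
  (scat W) ^t* *m (1%:M - Delta W *m (Delta W') ^t*) *m (obs W') ^t*.
Proof.
move=> gW gW'; rewrite -trf_scat //; last by case: gW.
have /(congr1 (fun M => M ^t*)) := trf_scat (proj2 gW') gW.
rewrite trmxCB !trmxC_mul JJC !trmxCK !mulmxA => ->.
by rewrite trmxCB trmxC_mul trmxC1 !trmxCK.
Qed.

Definition gam k n (W : 'I_N -> 'M[C]_n) (a : 'cV_n) :=
  locked (obs W *m tcol r a *m Pi k).
Definition sig k n (W : 'I_N -> 'M[C]_n) (a : 'cV_n) :=
  locked ((scat W) ^t* *m tcol r a *m Pi k).

Lemma gam_intertwine k m n (W : 'I_N -> 'M[C]_n) (V : 'I_N -> 'M[C]_m) L a :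
    pencil X W \in unitmx -> pencil X V \in unitmx ->
    (forall k, V k *m L = L *m W k) ->
  (1%:M *t L) *m gam k W a = gam k V (L *m a).
Proof.
move=> uW uV LW.
rewrite /gam -!lock !mulmxA (obs_intertwine uW uV LW).
by rewrite -[_ *m _ *m tcol _ _]mulmxA tens_tcol mulmx1.
Qed.

(** S(W)^H is f(W) J x(W)^H, and moving [L] past x(W)^H takes the relation for [L ^t*], hence the
    second intertwining hypothesis. *)
Lemma sig_intertwine k m n (W : 'I_N -> 'M[C]_n) (V : 'I_N -> 'M[C]_m) L a :
    pencil X W \in unitmx -> pencil X V \in unitmx ->
    (forall k, V k *m L = L *m W k) ->
    (forall k, W k *m L ^t* = L ^t* *m V k) ->
  (1%:M *t L) *m sig k W a = sig k V (L *m a).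
Proof.
move=> uW uV LW LV.
suff LS : (1%:M *t L) *m (scat W) ^t* = (scat V) ^t* *m (1%:M *t L).
  by rewrite /sig -!lock !mulmxA LS -[_ *m _ *m tcol _ _]mulmxA tens_tcol mulmx1.
rewrite /scat -!lock !trmxC_mul !trmxCK !mulmxA (trf_intertwine uW uV LW).
rewrite -[_ *m (JJ n) ^t*]mulmxA !JJC tens_comm.
have := congr1 (fun M => M ^t*) (ctr_intertwine uV uW LV).
rewrite !trmxC_mul !trmxC_tens !trmxC1 trmxCK => LX.
by rewrite -!mulmxA LX.
Qed.

Definition nrm n (a : 'cV[C]_n) : C := (a ^t* *m a) 0 0.

Lemma nrm_ge0 n (a : 'cV[C]_n) : 0 <= nrm a.
Proof.
rewrite /nrm mxE sumr_ge0 // => i _.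
by rewrite !mxE mulrC mul_conjC_ge0.
Qed.

Lemma nrm_gt0 n (a : 'cV[C]_n) : a != 0 -> 0 < nrm a.
Proof.
move=> a0; rewrite lt0r nrm_ge0 andbT; apply: contraNneq a0 => a20.
apply/eqP/colP => i; rewrite [RHS]mxE; apply/eqP.
rewrite -mul_conjC_eq0; apply/eqP.
have /psumr_eq0P : \sum_j a j 0 * (a j 0)^* = 0.
  rewrite -[RHS]a20 /nrm mxE; apply: eq_bigr => j _.
  by rewrite !mxE mulrC.
by apply=> // j _; rewrite mul_conjC_ge0.
Qed.

(* [pert k W a s] multiplies [W k] on the left by 1 - (1 - s) a a^* / |a|^2;
   [pert0] and [pert1] are its coefficients as an affine function of [s]. *)
Definition pert0 k n (W : 'I_N -> 'M[C]_n) (a : 'cV_n) j : 'M[C]_n :=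
  if j == k then W j - (nrm a)^-1 *: (a *m a ^t* *m W j) else W j.
Definition pert1 k n (W : 'I_N -> 'M[C]_n) (a : 'cV_n) j : 'M[C]_n :=
  if j == k then (nrm a)^-1 *: (a *m a ^t* *m W j) else 0.
Definition pert k n W (a : 'cV[C]_n) s j := pert0 k W a j + s *: pert1 k W a j.

Lemma pert_at1 k n W (a : 'cV[C]_n) j : pert k W a 1 j = W j.
Proof.
by rewrite /pert /pert0 /pert1; case: eqP; rewrite ?scale1r ?addr0 ?subrK.
Qed.

Section Pert.
Variables (k : 'I_N) (n : nat) (W : 'I_N -> 'M[C]_n) (a : 'cV[C]_n).
Hypotheses (a0 : a != 0) (uW : forall j, W j \is unitarymx).
Let E : 'M[C]_n := (nrm a)^-1 *: (a *m a ^t*).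

Lemma pertE s j : pert k W a s j =
  if j == k then (1%:M - (1 - s) *: E) *m W j else W j.
Proof.
rewrite /pert /pert0 /pert1; case: eqP => _; last by rewrite scaler0 addr0.
rewrite mulmxBl mul1mx -scalemxAl scalerBl scale1r opprB /E -scalemxAl.
by rewrite addrCA addrC.
Qed.

Lemma proj_EE : E *m E = E.
Proof.
rewrite -scalemxAl -scalemxAr mulmxA -[a *m _ *m a]mulmxA [a ^t* *m a]mx11_scalar.
rewrite mul_mx_scalar -scalemxAl -/(nrm a) scalerA.
rewrite [X in _ *: (X *: _)]mulVf ?scale1r //.
by rewrite gt_eqF ?nrm_gt0.
Qed.

Lemma proj_EC : E ^t* = E.
Proof.
rewrite trmxCZ trmxC_mul trmxCK geC0_conj //.
by rewrite invr_ge0 nrm_ge0.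
Qed.

(** As E is an orthogonal projection, the matrices 1 - (1 - s) E multiply like the numbers s. *)
Lemma pert_mulC s t j : pert k W a s j *m (pert k W a t j) ^t* =
  if j == k then 1%:M - (1 - s * t^*) *: E else 1%:M.
Proof.
rewrite !pertE; case: eqP => _; last exact/unitarymxP.
rewrite trmxC_mul mulmxA mulmxtVK // trmxCB trmxC1 trmxCZ proj_EC.
rewrite mulmxBl mul1mx mulmxBr mulmx1 -scalemxAl -scalemxAr proj_EE.
rewrite [_ *: (_ *: E)]scalerA -scalerBl -addrA -opprD -scalerDl rmorphB rmorph1.
congr (_ - _ *: _); ring.
Qed.

Lemma mul_pertC t j : W j *m (pert k W a t j) ^t* =
  if j == k then 1%:M - (1 - t^*) *: E else 1%:M.
Proof. by rewrite -{1}(pert_at1 k W a j) pert_mulC mul1r. Qed.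

Lemma pert_unitary s j : s * s^* = 1 -> pert k W a s j \is unitarymx.
Proof.
move=> s1; apply/unitarymxP; rewrite pert_mulC s1 subrr scale0r subr0.
by case: ifP.
Qed.

(** Only the k-th term of 1 - Delta(V) survives, and 1 (x) a a^H factors through [tcol] and [trow].
    This turns [scat_sym] into a relation between [gam] and [sig]. *)
Lemma Delta_pert c (V : 'I_N -> 'M[C]_n) :
    (forall j, V j = if j == k then 1%:M - c *: E else 1%:M) ->
  1%:M - Delta V = (c * (nrm a)^-1) *: (tcol r a *m Pi k *m trow r (a ^t*)).
Proof.
move=> VE; rewrite -Delta1 /Delta /tsum -sumrB (bigD1 k) //=.
rewrite big1 ?addr0 => [|j /negPf jk]; last by rewrite VE jk subrr.
rewrite VE eqxx -tensmxBr opprB addrC subrK tensmxZr tensmxZr scalerA.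
congr (_ *: _); rewrite -tens1_tcol -mulmxA tcol_trow tensmx_mul.
by rewrite mulmx1 mul1mx.
Qed.

Lemma pert_affine s : pencil X (pert k W a s) =
  pencil X (pert0 k W a) + s *: - tsum X (pert1 k W a).
Proof. exact: pencil_affine. Qed.

End Pert.

(* With a left inverse [L] on the range of [Pi k], the matrix [M0 + s *: M1] has
   Schur complement [1 - Pi k + L *m gam], invertible iff [gam] still has a left
   inverse there; at [s = 1] it is the identity. *)
Lemma regular_pert k n (W : 'I_N -> 'M[C]_n) a L :
    Q W -> L *m gam k W a = Pi k ->
  let M0 := block_mx (pencil X (pert0 k W a)) (tcol r a *m Pi k)
    (- (L *m (K *t 1%:M))) (1%:M - Pi k) in
  let M1 := block_mx (- tsum X (pert1 k W a)) 0 0 0 in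
  [/\ Q (pert k W a 1), M0 + 1 *: M1 \in unitmx &
    forall s, Q (pert k W a s) -> M0 + s *: M1 \in unitmx ->
      exists L', L' *m gam k (pert k W a s) a = Pi k].
Proof.
move=> QW LW M0 M1.
have W1 : pert k W a 1 = W.
  by apply: functional_extensionality_dep => j; apply: pert_at1.
have ME s : Q (pert k W a s) -> (M0 + s *: M1 \in unitmx) =
    (1%:M - Pi k + L *m gam k (pert k W a s) a \in unitmx).
  move=> Qs; rewrite scale_block_mx add_block_mx !scaler0 !addr0 -pert_affine.
  rewrite schur_unitmx ?QP // !mulNmx opprK /gam /obs -!lock !mulmxA.
  by rewrite -[X in _ + X]mulmxA.
split=> [||s Qs]; first by rewrite W1.
  by rewrite ME W1 // LW subrK unitmx1.
rewrite ME // => uM.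
set M := 1%:M - Pi k + _ in uM.
exists (invmx M *m L); rewrite -mulmxA.
suff -> : L *m gam k (pert k W a s) a = M *m Pi k by rewrite mulKmx.
by rewrite mulmxDl mulmxBl mul1mx PiK subrr add0r /gam -!lock -!mulmxA PiK.
Qed.

Lemma gam_sig k n (W V : 'I_N -> 'M[C]_n) a c :
    good W -> good V -> c != 0 ->
    1%:M - Delta W *m (Delta V) ^t* =
      c *: (tcol r a *m Pi k *m trow r (a ^t*)) ->
  gam k W a *m (sig k V a) ^t* = sig k W a *m (gam k V a) ^t*.
Proof.
move=> gW gV c0 cE; have := scat_sym gW gV; rewrite cE.
rewrite -!scalemxAr -!scalemxAl => /(scalerI c0).
rewrite /gam /sig -!lock !trmxC_mul !PiC !trmxCK trmxC_tcol !mulmxA.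
by rewrite -![_ *m Pi k *m Pi k]mulmxA PiK.
Qed.

(** V is [pert k W a t] for a generic t on the circle, where a left inverse persists by
    [regular_pert]. As t is not 1, the scalar in front of the middle factor can be cancelled. *)
Lemma pert_exists k n (W : 'I_N -> 'M[C]_n) a L :
    a != 0 -> good W -> L *m gam k W a = Pi k ->
  exists (V : 'I_N -> 'M[C]_n) L', [/\ good V, L' *m gam k V a = Pi k &
    gam k W a *m (sig k V a) ^t* = sig k W a *m (gam k V a) ^t*].
Proof.
move=> a0 gW LW; have [uW QW] := gW.
have [Q1 U1 Us] := regular_pert QW LW.
have [t [t1 tn1 Qt /(Us t Qt)[L' L'E]]] := regular_circle regQ Q1 U1.
have gV : good (pert k W a t) by split=> // j; apply: pert_unitary.
exists (pert k W a t), L'; split=> //.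
apply: (@gam_sig k n W (pert k W a t) a ((1 - t^*) * (nrm a)^-1)) => //.
  apply: mulf_neq0; last by rewrite invr_eq0 gt_eqF ?nrm_gt0.
  rewrite subr_eq0 eq_sym.
  by apply: contra tn1 => /eqP tC; rewrite -[t]conjCK tC rmorph1.
rewrite DeltaC DeltaM; apply: Delta_pert => // j.
exact: mul_pertC.
Qed.

Lemma good_dsum m n (W : 'I_N -> 'M[C]_m) (V : 'I_N -> 'M[C]_n) :
  good W -> good V -> good (dsum W V).
Proof.
move=> [uW QW] [uV QV]; split; last exact: (regular_dsum regQ).
move=> k; apply/unitarymxP; rewrite tr_block_mx map_block_mx mulmx_block.
rewrite !trmx0 !map_mx0 !mulmx0 !mul0mx !addr0 !add0r.
by rewrite (unitarymxP (uW k)) (unitarymxP (uV k)) -scalar_mx_block.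
Qed.

Section DirectSum.
Variables (m n : nat) (W : 'I_N -> 'M[C]_m) (V : 'I_N -> 'M[C]_n).
Hypotheses (gW : good W) (gV : good V).
Variables (a : 'cV[C]_m) (b : 'cV[C]_n).
Let L1 : 'M[C]_(m, m + n) := row_mx 1%:M 0.
Let L2 : 'M[C]_(n, m + n) := row_mx 0 1%:M.

Let L1W k : W k *m L1 = L1 *m dsum W V k.
Proof.
by rewrite mul_mx_row mul_row_block !mulmx0 !mul0mx mul1mx mulmx1 !addr0.
Qed.

Let L2W k : V k *m L2 = L2 *m dsum W V k.
Proof.
by rewrite mul_mx_row mul_row_block !mulmx0 !mul0mx mul1mx mulmx1 !add0r.
Qed.

Let L1C : L1 ^t* = col_mx 1%:M 0.
Proof. by rewrite tr_row_mx map_col_mx trmx1 trmx0 map_mx1 map_mx0. Qed.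

Let L2C : L2 ^t* = col_mx 0 1%:M.
Proof. by rewrite tr_row_mx map_col_mx trmx1 trmx0 map_mx1 map_mx0. Qed.

Let uW : pencil X W \in unitmx. Proof. by apply: QP; case: gW. Qed.
Let uV : pencil X V \in unitmx. Proof. by apply: QP; case: gV. Qed.
Let uWV : pencil X (dsum W V) \in unitmx.
Proof. by apply: QP; case: (good_dsum gW gV). Qed.

Lemma gam_dsuml k :
  (1%:M *t L1) *m gam k (dsum W V) (col_mx a b) = gam k W a.
Proof.
by rewrite (gam_intertwine _ _ uWV uW L1W) mul_row_col mul1mx mul0mx addr0.
Qed.

Lemma gam_dsumr k :
  (1%:M *t L2) *m gam k (dsum W V) (col_mx a b) = gam k V b.
Proof.
by rewrite (gam_intertwine _ _ uWV uV L2W) mul_row_col mul1mx mul0mx add0r.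
Qed.

Lemma sig_dsuml k :
  (1%:M *t L1) *m sig k (dsum W V) (col_mx a b) = sig k W a.
Proof.
rewrite (sig_intertwine _ _ uWV uW L1W) => [|j].
  by rewrite mul_row_col mul1mx mul0mx addr0.
by rewrite L1C dsum_pid1.
Qed.

Lemma sig_dsumr k :
  (1%:M *t L2) *m sig k (dsum W V) (col_mx a b) = sig k V b.
Proof.
rewrite (sig_intertwine _ _ uWV uV L2W) => [|j].
  by rewrite mul_row_col mul1mx mul0mx add0r.
by rewrite L2C dsum_pid2.
Qed.

End DirectSum.

Lemma good_exists1 : exists W : 'I_N -> 'M[C]_1, good W.
Proof.
pose Y (_ : 'I_N) : 'M[C]_1 := 0; pose Z (_ : 'I_N) : 'M[C]_1 := 1%:M.
have Q0 : Q (fun k => Y k + 0 *: Z k).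
  by apply: (regular_strict_upper regQ) => k i j _; rewrite scale0r addr0 mxE.
have U0 : 1%:M + 0 *: 0 \in @unitmx C 1 by rewrite scale0r addr0 unitmx1.
have [t [t1 _ Qt _]] := regular_circle regQ Q0 U0.
exists (fun k => Y k + t *: Z k); split=> // k; apply/unitarymxP.
by rewrite add0r trmxCZ trmxC1 -scalemxAl mul1mx scalerA t1 scale1r.
Qed.

Lemma gam_detect k (v : 'cV[C]_r) : Pi k *m v != 0 ->
  exists n (W : 'I_N -> 'M[C]_n) a, good W /\ gam k W a *m v != 0.
Proof.
move=> v0; have [w nz] : exists w, K *m mxword X w *m Pi k *m v != 0.
  apply: contrapT => nex; case/eqP: v0; apply: Kobs => w.
  by apply/eqP; apply: contraT => nz; case: nex; exists w.
have /rV0Pn[i iE] : (K *m mxword X w *m Pi k *m v)^T != 0 by rewrite trmx_eq0.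
pose phi : 'rV[C]_q := delta_mx 0 i.
have : (phi *m K) *m mxword X w *m Pi k *m (Pi k *m v) != 0.
  rewrite mulmxA -[_ *m Pi k *m Pi k]mulmxA PiK.
  apply: contra iE => /eqP e0; apply/eqP.
  transitivity ((phi *m (K *m mxword X w *m Pi k *m v)) 0 0).
    by rewrite -rowE !mxE.
  by rewrite !mulmxA e0 mxE.
case/(regular_detect regQ) => n [W [a [b [uW QW _ uPW nz']]]].
(* Against Pi_k v only the k-th term [tcol r (W k *m a) *m Pi k] of [tsum Pi W *m tcol r a]
   survives, which dictates the vector. *)
exists n, W, (W k *m a); split=> //; apply: contra nz' => /eqP gv0.
rewrite -[phi *m K *m _]mulmxA -trow_tens1 [phi *m (_ *m _)]mulmxA.
rewrite -[_ *m (K *t 1%:M) *m invmx _]mulmxA.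
have -> : (K *t 1%:M) *m invmx (pencil X W) = obs W by rewrite /obs -lock.
rewrite -!mulmxA [tsum Pi W *m _]mulmxA tsum_tcol mulmx_suml.
rewrite (bigD1 k) //= big1 ?addr0 => [|j /negPf jk]; last first.
  by rewrite -mulmxA [Pi j *m _]mulmxA PiM jk scale0r mul0mx mulmx0.
move: gv0; rewrite /gam -!lock -!mulmxA => gv0.
by rewrite [Pi k *m (Pi k *m v)]mulmxA PiK gv0 !mulmx0.
Qed.

(** If Pi_k is not in the row space of [gam k W a], some v with Pi_k v nonzero is killed by
    [gam k W a]. A point detecting v is added as a direct summand; this raises the rank, which is at
    most r. *)
Lemma base_exists k : exists n (W : 'I_N -> 'M[C]_n) a L,
  [/\ a != 0, good W & L *m gam k W a = Pi k].
Proof.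
suff IH d : forall n (W : 'I_N -> 'M[C]_n) a, a != 0 -> good W ->
    (r - \rank (gam k W a) < d)%N -> exists n (W : 'I_N -> 'M[C]_n) a L,
    [/\ a != 0, good W & L *m gam k W a = Pi k].
  have [W gW] := good_exists1.
  have one_neq0 : (1%:M : 'M[C]_1) != 0 by rewrite -unitmx11 unitmx1.
  exact: (IH _ _ _ _ one_neq0 gW (ltnSn _)).
elim: d => // d IHd n W a a0 gW; rewrite ltnS => ltd.
have [/submxP[L LE]|nsub] := boolP (Pi k <= gam k W a)%MS.
  by exists n, W, a, L.
have [v gv0 Pv] : exists2 v : 'cV_r, gam k W a *m v = 0 & Pi k *m v != 0.
  move: nsub; rewrite submxE => /matrix0Pn[i [j ij]].
  exists (col j (cokermx (gam k W a))).
    by rewrite colE mulmxA mulmx_coker mul0mx.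
  by rewrite colE mulmxA -colE; apply/matrix0Pn; exists i, 0; rewrite mxE.
have [m [V [b [gV gVb]]]] := gam_detect Pv.
have ab0 : col_mx a b != 0.
  by rewrite col_mx_eq0 negb_and a0.
apply: (IHd _ _ _ ab0 (good_dsum gW gV)).
have sub : (gam k W a <= gam k (dsum W V) (col_mx a b))%MS.
  by rewrite -(gam_dsuml gW gV a b k) submxMl.
have nsub' : ~~ (gam k (dsum W V) (col_mx a b) <= gam k W a)%MS.
  apply: contra gVb => /submxP[M ME].
  rewrite -(gam_dsumr gW gV a b k) ME.
  by rewrite -[_ *m (M *m _) *m v]mulmxA -[M *m _ *m v]mulmxA gv0 !mulmx0.
have /rank_ltmx lt : (gam k W a < gam k (dsum W V) (col_mx a b))%MS.
  by rewrite ltmxE sub.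
apply: leq_trans ltd; rewrite ltn_sub2l //.
by apply: leq_trans lt _; apply: rank_leq_col.
Qed.

(** G is read off at a base point where [gam] has a left inverse. Any other W is compared with it
    inside the direct sum of the two, where [pert_exists] gives sig = gam G' with a single G'. *)
Lemma sig_gam k : exists G, [/\ Pi k *m G = G, G *m Pi k = G, G ^t* = G &
  forall n (W : 'I_N -> 'M[C]_n) a, good W -> sig k W a = gam k W a *m G].
Proof.
have [n0 [W0 [a0 [L0 [a0n0 gW0 L0E]]]]] := base_exists k.
have gamPi n (W : 'I_N -> 'M[C]_n) a : gam k W a *m Pi k = gam k W a.
  by rewrite /gam -!lock -mulmxA PiK.
have sigPi n (W : 'I_N -> 'M[C]_n) a : sig k W a *m Pi k = sig k W a.
  by rewrite /sig -!lock -mulmxA PiK.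
have [G G_def] : {G | G = L0 *m sig k W0 a0} by eexists.
have sigE n (W : 'I_N -> 'M[C]_n) a : good W ->
    Pi k *m G = G /\ sig k W a = gam k W a *m G.
  move=> gW; pose L : 'M[C]_(n0, n + n0) := row_mx 0 1%:M.
  have LE : L0 *m (1%:M *t L) *m gam k (dsum W W0) (col_mx a a0) = Pi k.
    by rewrite -mulmxA gam_dsumr.
  have aa0 : col_mx a a0 != 0.
    by rewrite col_mx_eq0 negb_and a0n0 orbT.
  have [V [L' [gV L'E]]] := pert_exists aa0 (good_dsum gW gW0) LE.
  move=> /(congr1 (fun M => M *m L' ^t*)); rewrite -!mulmxA -!trmxC_mul L'E PiC.
  rewrite sigPi; set G' := (L' *m _) ^t* => GE.
  (* Compression to the base point identifies [G] with Pi_k G'; compression to W then gives the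
     claim. *)
  have G'E : G = Pi k *m G'.
    by rewrite G_def -(sig_dsumr gW gW0 a a0) -GE !mulmxA LE.
  split; first by rewrite G'E mulmxA PiK.
  rewrite -(sig_dsuml gW gW0 a a0) -GE mulmxA gam_dsuml // G'E mulmxA.
  by rewrite gamPi.
have [PG _] := sigE _ _ a0 gW0.
have GP : G *m Pi k = G by rewrite G_def -mulmxA sigPi.
exists G; split=> // [|n W a /(sigE _ _ a)[]//].
(* G is Hermitian: the relation now reads gam(W0) G^H gam(V)^H = gam(W0) G gam(V)^H, and the left
   inverses cancel the outer factors. *)
have [V [L' [gV L'E]]] := pert_exists a0n0 gW0 L0E.
rewrite (proj2 (sigE _ _ a0 gW0)) (proj2 (sigE _ _ a0 gV)) trmxC_mul.
move=> /(congr1 (fun M => L0 *m M *m L' ^t*)).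
rewrite !mulmxA L0E -![_ *m (gam k V a0) ^t* *m _]mulmxA -!trmxC_mul L'E PiC.
have -> : Pi k *m G ^t* = G ^t* by rewrite -{1}(PiC k) -trmxC_mul GP.
have -> : G ^t* *m Pi k = G ^t* by rewrite -{1}(PiC k) -trmxC_mul PG.
by rewrite PG GP.
Qed.

Lemma scat_obs : exists G, [/\ forall k, Pi k *m G = G *m Pi k, G ^t* = G &
  forall n (W : 'I_N -> 'M[C]_n), good W ->
    scat W = (G *t 1%:M) *m (obs W) ^t*].
Proof.
have /fin_all_exists[G GE] := sig_gam.
exists (\sum_k G k); split.
- move=> k; rewrite mulmx_sumr mulmx_suml; apply: eq_bigr => j _.
  have [<- <- _ _] := GE j.
  rewrite !mulmxA PiM -[_ *m Pi j *m Pi k]mulmxA PiM.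
  have [->|] := eqVneq k j; rewrite ?eqxx ?scale1r ?scale0r ?mul0mx ?mulmx0 //.
- by rewrite trmxC_sum; apply: eq_bigr => k _; case: (GE k).
move=> n W gW; rewrite -[LHS]trmxCK.
have -> : (scat W) ^t* = obs W *m ((\sum_k G k) *t 1%:M).
  apply: eq_tcol => j.
  rewrite -mulmxA tens1_tcol -[LHS]mulmx1 -{1}Pi1 !mulmxA !mulmx_sumr.
  apply: eq_bigr => k _; have [PG _ _ GS] := GE k.
  have := GS _ _ (delta_mx j 0) gW; rewrite /sig /gam -!lock => ->.
  by rewrite -mulmxA PG.
rewrite trmxC_mul trmxC_tens trmxC1; congr (_ *t _ *m _).
by rewrite trmxC_sum; apply: eq_bigr => k _; case: (GE k).
Qed.

(** Multiplying by [trow q b] and [tcol p a] with b a = 0 removes [M']; what remains is a quantity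
    that [regular_detect] makes nonzero as soon as [M] has a nonzero coefficient. *)
Lemma obs_inj p (M : 'M[C]_(r, p)) (M' : 'M[C]_(q, p)) :
    (forall n (W : 'I_N -> 'M[C]_n), good W ->
       obs W *m Delta W *m (M *t 1%:M) + M' *t 1%:M = 0) ->
  M = 0 /\ M' = 0.
Proof.
move=> MM'0; suff M0 : M = 0.
  have [W /MM'0] := good_exists1; rewrite M0 tens0mx mulmx0 add0r.
  by move/tensmx_eq0 => ->.
suff PM0 k : Pi k *m M = 0.
  by rewrite -[M]mul1mx -Pi1 mulmx_suml big1.
apply/matrixP => i j; rewrite [RHS]mxE.
suff /colP/(_ i) : Pi k *m col j M = 0 by rewrite colE mulmxA -colE !mxE.
apply: Kobs => w; apply/eqP; apply: contraT => nz.
have /rV0Pn[l] : (K *m mxword X w *m Pi k *m col j M)^T != 0 by rewrite trmx_eq0.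
set v := K *m mxword X w *m Pi k *m col j M => lE.
pose phi : 'rV[C]_q := delta_mx 0 l.
have : (phi *m K) *m mxword X w *m Pi k *m col j M != 0.
  apply: contra lE => /eqP e0; apply/eqP.
  transitivity ((phi *m v) 0 0); first by rewrite -rowE !mxE.
  by rewrite /v !mulmxA e0 mxE.
case/(regular_detect regQ) => n [W [a [b [uW QW ba0 uPW /eqP[]]]]].
rewrite -[phi *m K *m _]mulmxA -trow_tens1 [phi *m (_ *m _)]mulmxA.
rewrite -[_ *m (K *t 1%:M) *m invmx _]mulmxA.
have -> : (K *t 1%:M) *m invmx (pencil X W) = obs W by rewrite /obs -lock.
have [Y YE] : {Y | Y = phi *m trow q b} by eexists.
rewrite -/(Delta W) -YE colE mulmxA -[_ *m tcol r a *m M]mulmxA -tens1_tcol.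
rewrite [_ *m (_ *m tcol p a)]mulmxA -[Y *m _ *m _]mulmxA -[Y *m _ *m _]mulmxA.
have -> : obs W *m Delta W *m (M *t 1%:M) = - (M' *t 1%:M).
  by apply/eqP; rewrite -addr_eq0; apply/eqP/MM'0.
rewrite mulmxN !mulNmx YE -[_ *m (M' *t _)]mulmxA trow_tens1.
rewrite mulmxA -[_ *m trow _ _ *m _]mulmxA trow_tcol ba0 mxE.
by rewrite raddf0 mulmx0 mul0mx oppr0.
Qed.

Lemma colligation_J : exists G, [/\ forall k, Pi k *m G = G *m Pi k, G ^t* = G,
  forall n (W : 'I_N -> 'M[C]_n), good W ->
    scat W = (G *t 1%:M) *m (obs W) ^t*
  & block_mx A B K D *m block_mx G 0 0 J *m (block_mx A B K D) ^t* =
    block_mx G 0 0 J].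
Proof.
have [G [PG GC GE]] := scat_obs; exists G; split=> //.
(* [K1], [K2], [K3] and [K2 ^t*] are the blocks of U (G + J) U^H - (G + J). *)
pose K1 := A *m G *m A ^t* + B *m J *m B ^t* - G.
pose K2 := A *m G *m K ^t* + B *m J *m D ^t*.
pose K3 := K *m G *m K ^t* + D *m J *m D ^t* - J.
have K1C : K1 ^t* = K1.
  rewrite /K1 trmxCB trmxCD !trmxC_mul !trmxCK JC GC.
  by rewrite !mulmxA.
have K3C : K3 ^t* = K3.
  rewrite /K3 trmxCB trmxCD !trmxC_mul !trmxCK JC GC.
  by rewrite !mulmxA.
have obsCE n (W : 'I_N -> 'M[C]_n) : good W -> (obs W) ^t* =
    K ^t* *t 1%:M + (A ^t* *t 1%:M) *m ((Delta W) ^t* *m (obs W) ^t*).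
  case=> _ /QP uW; rewrite {1}(obsE uW) trmxCD !trmxC_mul !trmxC_tens trmxC1.
  by rewrite mulmxA.
have trfCE n (W : 'I_N -> 'M[C]_n) : (trf W) ^t* =
    D ^t* *t 1%:M + (B ^t* *t 1%:M) *m ((Delta W) ^t* *m (obs W) ^t*).
  rewrite /trf -lock trmxCD !trmxC_mul !trmxC_tens trmxC1.
  by rewrite !mulmxA.
have scatE n (W : 'I_N -> 'M[C]_n) : good W ->
    (Delta W) ^t* *m scat W =
    (A *t 1%:M) *m scat W + (B *t 1%:M) *m (J *t 1%:M) *m (trf W) ^t*.
  case=> uW /QP uPW; rewrite /scat -lock {1}(ctrE uPW) -!mulmxA.
  by rewrite [LHS]mulmxA Delta_unitaryr // mul1mx mulmxDl -!mulmxA.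
have arith1 (V : zmodType) (x1 x2 y1 y2 : V) :
    x1 + x2 - (y1 + x1 + (y2 + x2)) + (y1 + y2) = 0.
  rewrite [y1 + _ + _]addrACA opprD; move: (x1 + x2) (y1 + y2) => a b.
  by rewrite [- b - a]addrC addrA subrr add0r addNr.
have arith2 (V : zmodType) (x1 x2 y1 y2 : V) :
    x1 + x2 + (y1 + y2 - (y2 + x2 + (y1 + x1))) = 0.
  rewrite [y2 + _ + _]addrACA [y2 + y1]addrC [x2 + x1]addrC opprD.
  by move: (x1 + x2) (y1 + y2) => a b; rewrite [b + _]addrA subrr add0r subrr.
(* This is x(W) = Delta(W) (A x(W) + B) multiplied by J f(W)^H, with S(W) = G c(W)^H inserted. *)
have E12 n (W : 'I_N -> 'M[C]_n) : good W ->
    (K1 *t 1%:M) *m ((Delta W) ^t* *m (obs W) ^t*) + K2 *t 1%:M = 0.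
  move=> gW; have := scatE n W gW; rewrite GE // trfCE.
  rewrite [LHS]mulmxA DeltaC (Delta_comm _ PG) -DeltaC -[LHS]mulmxA.
  rewrite {2}(obsCE n W gW); move: ((Delta W) ^t* *m _) => z gz.
  rewrite /K1 /K2 tensmxBl !tensmxDl mulmxBl mulmxDl gz.
  rewrite !mulmxDr !mulmxA !tensmx_mul !mulmx1.
  exact: arith1.
(* This is f(W) J f(W)^H = J with the left factor written as D + K x(W). *)
have E23 n (W : 'I_N -> 'M[C]_n) : good W ->
    (K2 ^t* *t 1%:M) *m ((Delta W) ^t* *m (obs W) ^t*) + K3 *t 1%:M = 0.
  move=> gW; have := trfJ (proj1 gW) (proj2 gW).
  rewrite [X in X *m _ *m _]trfE mulmxDl mulmxDl.
  have -> : (K *t 1%:M) *m ctr W *m JJ n *m (trf W) ^t* =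
      (K *t 1%:M) *m scat W by rewrite /scat -lock !mulmxA.
  rewrite GE // trfCE; set z := (Delta W) ^t* *m _.
  rewrite (obsCE n W gW) -/z; move: z => z.
  rewrite /JJ /K2 /K3 !mulmxDr !mulmxA !tensmx_mul !mulmx1 => gz.
  rewrite trmxCD !trmxC_mul !trmxCK JC GC tensmxBl !tensmxDl mulmxDl -gz !mulmxA.
  exact: arith2.
have [M1 M2] : (K1 = 0) /\ (K2 ^t* = 0).
  apply: obs_inj => n W gW; have /(congr1 (fun M => M ^t*)) := E12 n W gW.
  by rewrite trmxCD !trmxC_mul !trmxC_tens !trmxCK !trmxC1 K1C trmxC0.
have [_ M3] : (K2 = 0) /\ (K3 = 0).
  apply: obs_inj => n W gW; have /(congr1 (fun M => M ^t*)) := E23 n W gW.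
  by rewrite trmxCD !trmxC_mul !trmxC_tens !trmxCK !trmxC1 K3C trmxC0.
have M2' : K2 = 0 by rewrite -[K2]trmxCK M2 trmxC0.
rewrite tr_block_mx map_block_mx !mulmx_block !mulmx0 !addr0 !add0r.
move/eqP: M1; rewrite subr_eq0 => /eqP ->.
move/eqP: M3; rewrite subr_eq0 => /eqP ->.
rewrite -/K2 M2'; move: M2; rewrite /K2 trmxCD !trmxC_mul !trmxCK JC GC !mulmxA.
by move=> ->.
Qed.

(** With z = c(W) Delta(W), the row [z, 1] times U is [c(W), f(W)]. Evaluating G + J on both rows
    gives the same result, as U preserves it. *)
Lemma trf_gram G n (W : 'I_N -> 'M[C]_n) :
    (forall k, Pi k *m G = G *m Pi k) ->
    block_mx A B K D *m block_mx G 0 0 J *m (block_mx A B K D) ^t* =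
      block_mx G 0 0 J -> Q W ->
  JJ n - trf W *m JJ n *m (trf W) ^t* =
  obs W *m ((1%:M - Delta W *m (Delta W) ^t*) *m (G *t 1%:M)) *m (obs W) ^t*.
Proof.
move=> PG UE /QP uPW; have := UE.
rewrite tr_block_mx map_block_mx !mulmx_block !mulmx0 !addr0 !add0r.
case/eq_block_mx => E1 E2 E3 E4.
have oE := obsE uPW.
have tE : trf W = D *t 1%:M + obs W *m Delta W *m (B *t 1%:M).
  by rewrite /trf -lock.
have [z zE] : {z | z = obs W *m Delta W} by eexists.
have zC : (Delta W) ^t* *m (obs W) ^t* = z ^t* by rewrite zE trmxC_mul.
rewrite -zE in oE tE.
pose U := block_mx (A *t 1%:M) (B *t 1%:M) (K *t 1%:M) (D *t (1%:M : 'M[C]_n)).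
pose H : 'M[C]_(r * n + q * n) := block_mx (G *t 1%:M) 0 0 (JJ n).
have UH : U *m H *m U ^t* = H.
  rewrite /U /H tr_block_mx map_block_mx !trmxC_tens !mulmx_block.
  rewrite !mulmx0 !addr0 !add0r /JJ trmxC1 !tensmx_mul !mulmx1 -!tensmxDl.
  by rewrite E1 E2 E3 E4 !tens0mx.
have zU : row_mx z 1%:M *m U = row_mx (obs W) (trf W).
  by rewrite /U mul_row_block !mul1mx [X in row_mx X _]addrC -oE addrC -tE.
have : row_mx (obs W) (trf W) *m H *m (row_mx (obs W) (trf W)) ^t* =
    row_mx z 1%:M *m H *m (row_mx z 1%:M) ^t*.
  by rewrite -zU trmxC_mul -[in RHS]UH !mulmxA.
rewrite /H !tr_row_mx !map_col_mx !mul_row_block !mul_row_col !mulmx0 !addr0.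
rewrite !add0r !mul1mx trmx1 map_mx1 mulmx1 => gE.
rewrite mulmxBl mul1mx mulmxBr mulmxBl.
have <- : z *m (G *t 1%:M) *m z ^t* =
    obs W *m (Delta W *m (Delta W) ^t* *m (G *t 1%:M)) *m (obs W) ^t*.
  rewrite -zC zE DeltaC -[Delta W *m _ *m (G *t _)]mulmxA (Delta_comm _ PG).
  by rewrite !mulmxA.
by apply/eqP; rewrite subr_eq addrAC eq_sym subr_eq [X in _ == X]addrC gE.
Qed.

Hypothesis trf_contractive : forall n (W : 'I_N -> 'M[C]_n),
  (forall k, lemx (W k *m (W k) ^t*) 1%:M) -> Q W ->
  lemx (trf W *m JJ n *m (trf W) ^t*) (JJ n).

(** The form splits along the blocks because G commutes with the projections. Perturbing W_k at a
    base point with 0 < s < 1 gives contractions, where J - f J f^H is a positive multiple of gam G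
    gam^H. *)
Lemma gramian_ge0 G : (forall k, Pi k *m G = G *m Pi k) ->
    block_mx A B K D *m block_mx G 0 0 J *m (block_mx A B K D) ^t* =
      block_mx G 0 0 J ->
  forall v : 'cV_r, 0 <= (v ^t* *m G *m v) 0 0.
Proof.
move=> PG UE v; rewrite -[G]mul1mx -Pi1 mulmx_suml mulmx_sumr mulmx_suml summxE.
apply: sumr_ge0 => k _.
have [n [W [a [L [a0 gW LE]]]]] := base_exists k; have [uW QW] := gW.
have [Q1 U1 Us] := regular_pert QW LE.
have [s [s0 s1 Qs /(Us s Qs)[L' L'E]]] := regular_interval regQ Q1 U1.
have sC : s^* = s by apply: geC0_conj; apply: ltW.
have ss : 0 < 1 - s * s by rewrite subr_gt0 mulr_ilt1 // ltW.
have contr j : lemx (pert k W a s j *m (pert k W a s j) ^t*) 1%:M.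
  move=> x; rewrite pert_mulC //; case: eqP => _; last first.
    by rewrite subrr mulmx0 mul0mx mxE.
  rewrite opprB addrC subrK sC -scalemxAr -scalemxAl mxE.
  apply: mulr_ge0; first exact: ltW.
  rewrite -scalemxAr -scalemxAl mxE mulr_ge0 ?invr_ge0 ?nrm_ge0 //.
  have -> : x ^t* *m (a *m a ^t*) *m x = (a ^t* *m x) ^t* *m (a ^t* *m x).
    by rewrite trmxC_mul trmxCK !mulmxA.
  exact: nrm_ge0.
have := trf_contractive contr Qs.
rewrite /lemx (trf_gram PG UE Qs) DeltaC DeltaM.
rewrite (@Delta_pert k n a (1 - s * s^*)); last by move=> j; apply: pert_mulC.
(* As [L'] is a left inverse of [gam], this vector turns the form gam G gam^H into that of Pi_k G at
   [v]. *)
move=> /(_ (L' ^t* *m v)).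
set g := obs _ *m _ *m _.
have -> : g = ((1 - s * s^*) / nrm a) *: (gam k (pert k W a s) a *m G *m
    (gam k (pert k W a s) a) ^t*).
  rewrite /g /gam -!lock -!scalemxAl -!scalemxAr -!scalemxAl; congr (_ *: _).
  rewrite !trmxC_mul PiC trmxC_tcol -[_ *m Pi k *m G]mulmxA.
  rewrite -!mulmxA; do 2 congr (_ *m _).
  rewrite [trow _ _ *m (_ *m _)]mulmxA trow_tens1 -mulmxA.
  by rewrite [G *m (Pi k *m _)]mulmxA -PG -mulmxA [RHS]mulmxA PiK.
rewrite -scalemxAr -scalemxAl mxE pmulr_rge0; last first.
  by rewrite divr_gt0 ?nrm_gt0 // sC.
rewrite trmxC_mul trmxCK !mulmxA -[v ^t* *m L' *m _]mulmxA L'E.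
rewrite -![_ *m (gam k _ a) ^t* *m _]mulmxA -[_ *m (_ *m L' ^t*)]mulmxA.
rewrite -trmxC_mul L'E PiC -PG [_ *m (Pi k *m G)]mulmxA.
by rewrite -[_ *m Pi k *m Pi k]mulmxA PiK.
Qed.

Hypothesis Bctr : forall k (l : 'rV_r),
  (forall w j, l *m Pi k *m mxword X w *m (Pi j *m B) = 0) -> l *m Pi k = 0.

(** J-unitarity gives x(W) = S(W) J f(W) = G c(W)^H J f(W), so the blocks of a row annihilating G
    annihilate x(W) at all good points; controllability and [regular_detect] exclude this for a
    nonzero block. *)
Lemma gramian_unit G : (forall k, Pi k *m G = G *m Pi k) ->
    (forall n (W : 'I_N -> 'M[C]_n), good W ->
      scat W = (G *t 1%:M) *m (obs W) ^t*) ->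
  G \in unitmx.
Proof.
move=> PG GE; apply: row_inj_unitmx => l lG0.
suff lP0 k : l *m Pi k = 0 by rewrite -[l]mulmx1 -Pi1 mulmx_sumr big1.
apply: Bctr => w j; apply/eqP; apply: contraT => /rV0Pn[i iE].
have : l *m Pi k *m mxword X w *m (Pi j *m B) *m
    (delta_mx i 0 : 'cV_q) != 0.
  apply: contra iE => /eqP; rewrite -colE => /colP/(_ 0).
  by rewrite mxE => ->; rewrite mxE.
case/(regular_detect (Y := fun j => Pi j *m B) regQ).
move=> n [W [a [b [uW QW _ uPW /eqP[]]]]].
have gW : good W by [].
have ctr_scat : ctr W = scat W *m JJ n *m trf W.
  have T1 : (JJ n *m (trf W) ^t* *m JJ n) *m trf W = 1%:M.
    by apply: mulmx1C; rewrite !mulmxA trfJ // JJ2.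
  by rewrite /scat -lock -[LHS]mulmx1 -T1 !mulmxA.
have lx0 : ((l *m Pi k) *t 1%:M) *m ctr W = 0.
  rewrite ctr_scat GE // !mulmxA tensmx_mul -[l *m _ *m G]mulmxA PG mulmxA.
  by rewrite lG0 mul0mx tens0mx !mul0mx.
have -> : tsum (fun j => Pi j *m B) W = Delta W *m (B *t 1%:M).
  by rewrite tsum_tens; apply: eq_tsum => s; rewrite ?mulmx1.
rewrite -trow_tens1 -[_ *m invmx _ *m _]mulmxA [invmx _ *m _]mulmxA.
have -> : invmx (pencil X W) *m Delta W *m (B *t 1%:M) = ctr W.
  by rewrite /ctr -lock.
by rewrite -[trow _ _ *m _ *m ctr W]mulmxA lx0 mulmx0 !mul0mx.
Qed.

End JUnitary.
End Colligation.

(** * Resolvents as polynomials in a matrix *)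

Section Horner.
Variable F : fieldType.

Lemma horner_mx_poly (m : nat) (M : 'M[F]_m.+1) (p : {poly F}) :
  horner_mx M p = \sum_(i < size p) p`_i *: M ^+ i.
Proof.
rewrite -[p in LHS]coefK poly_def rmorph_sum /=; apply: eq_bigr => i _.
by rewrite -mul_polyC rmorphM rmorphXn /= horner_mx_C horner_mx_X -mul_scalar_mx.
Qed.

Lemma horner_mx_iter m s (M : 'M[F]_m.+1) (p : {poly F}) (X : 'M_(m.+1, s)) :
  horner_mx M p *m X = \sum_(i < size p) p`_i *: iter i (mulmx M) X.
Proof.
rewrite horner_mx_poly mulmx_suml; apply: eq_bigr => i _.
rewrite -scalemxAl; congr (_ *: _).
elim: (nat_of_ord i) => [|k IHk]; first by rewrite expr0 mul1mx.
by rewrite exprS -mulmxE -mulmxA IHk.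
Qed.

(** By Cayley-Hamilton chi(M) = 0, that is, p(M) (1 - M) = c. *)
Lemma invmx_sub1_iter m s (M : 'M[F]_m) (chi p : {poly F}) c (X : 'M_(m, s)) :
    char_poly M %| chi -> chi = p * ('X - 1%:P) + c%:P -> c != 0 ->
    1%:M - M \in unitmx ->
  invmx (1%:M - M) *m X = c^-1 *: \sum_(i < size p) p`_i *: iter i (mulmx M) X.
Proof.
case: m M X => [|m] M X dvd_chi chiE c0 uM; first by rewrite !flatmx0.
have /eqP chi0 : horner_mx M chi = 0.
  by case/dvdpP: dvd_chi => d ->; rewrite rmorphM /= Cayley_Hamilton mulr0.
rewrite -horner_mx_iter scalemxAl; congr (_ *m _).
move: chi0; rewrite chiE rmorphD rmorphM rmorphB /= horner_mx_X !horner_mx_C.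
rewrite addr_eq0 -[M - _]opprB mulrN eqr_opp -mulmxE => /eqP pM.
rewrite -[RHS](mulmxK uM) -scalemxAl pM -[LHS]mul1mx; congr (_ *m _).
by rewrite scale_scalar_mx mulVf.
Qed.

(** The product of the characteristic polynomials annihilates both matrices and does not vanish at
    1; dividing it by X - 1 supplies coefficients valid for both. *)
Lemma invmx_sub1_common m m' (M : 'M[F]_m) (M' : 'M[F]_m') :
    1%:M - M \in unitmx -> 1%:M - M' \in unitmx ->
  exists d (e : 'I_d -> F), forall s,
    (forall X : 'M_(m, s),
       invmx (1%:M - M) *m X = \sum_i e i *: iter i (mulmx M) X) /\
    (forall X : 'M_(m', s),
       invmx (1%:M - M') *m X = \sum_i e i *: iter i (mulmx M') X).
Proof.
move=> uM uM'; pose chi := char_poly M * char_poly M'.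
have nroot l (L : 'M[F]_l) : 1%:M - L \in unitmx -> (char_poly L).[1] != 0.
  move=> uL; apply/negP => /eqP/rootP; rewrite -eigenvalue_root_char.
  case/eigenvalueP => v vL; case/negP; apply/eqP; apply: (row_unitmx0 uL).
  by rewrite mulmxBr mulmx1 vL scale1r subrr.
have c0 : chi.[1] != 0 by rewrite hornerM mulf_neq0 ?nroot.
have /factor_theorem[p pE] : root (chi - (chi.[1])%:P) 1.
  by rewrite rootE !hornerE subrr.
have chiE : chi = p * ('X - 1%:P) + (chi.[1])%:P by rewrite -pE subrK.
exists (size p), (fun i => (chi.[1])^-1 * p`_i) => s; split=> X.
  rewrite (invmx_sub1_iter X _ chiE c0 uM) ?dvdp_mulIl // scaler_sumr.
  by apply: eq_bigr => i _; rewrite scalerA.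
rewrite (invmx_sub1_iter X _ chiE c0 uM') ?dvdp_mulIr // scaler_sumr.
by apply: eq_bigr => i _; rewrite scalerA.
Qed.

End Horner.

(** * Rational expressions and Fornasini-Marchesini realizations *)

Section FM.
Variables (F : fieldType) (N : nat).

(* A Fornasini-Marchesini realization
   [D + C (1 - \sum_k z_k A_k)^{-1} \sum_k z_k B_k]. *)
Record fm_node (p s : nat) := FMNode {
  fm_dim : nat;
  fm_A : 'I_N -> 'M[F]_fm_dim;
  fm_B : 'I_N -> 'M[F]_(fm_dim, s);
  fm_C : 'M[F]_(p, fm_dim);
  fm_D : 'M[F]_(p, s) }.

Section Node.
Variables (p s : nat) (a : fm_node p s).

Fixpoint fm_tail (j : 'I_N) (w : seq 'I_N) : 'M[F]_(fm_dim a, s) :=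
  if w is j' :: w' then fm_A a j *m fm_tail j' w' else fm_B a j.

Definition fm_coef (w : seq 'I_N) : 'M[F]_(p, s) :=
  if w is j :: w' then fm_C a *m fm_tail j w' else fm_D a.

Definition fm_pencil n (W : 'I_N -> 'M[F]_n) := pencil (fm_A a) W.

Definition fm_obs n (W : 'I_N -> 'M[F]_n) :=
  locked ((fm_C a *t 1%:M) *m invmx (fm_pencil W)).

Definition fm_eval n (W : 'I_N -> 'M[F]_n) : 'M[F]_(p * n, s * n) :=
  fm_D a *t 1%:M + fm_obs W *m tsum (fm_B a) W.

Lemma fm_obsP n (W : 'I_N -> 'M[F]_n) : fm_pencil W \in unitmx ->
  fm_obs W *m fm_pencil W = fm_C a *t 1%:M.
Proof. by move=> uW; rewrite /fm_obs -lock mulmxKV. Qed.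

Lemma fm_obs_unique n (W : 'I_N -> 'M[F]_n) X : fm_pencil W \in unitmx ->
  X *m fm_pencil W = fm_C a *t 1%:M -> X = fm_obs W.
Proof. by move=> uW XE; rewrite -[X](mulmxK uW) XE /fm_obs -lock. Qed.

(** The state part of a convolution product whose first letter [j] is read by the node. Its
    recursion in the word is that of the tails of a cascade or of an inverse node. *)
Definition fm_conv t (f : seq 'I_N -> 'M[F]_(s, t)) j w : 'M[F]_(_, t) :=
  \sum_(i < (size w).+1) fm_tail j (take i w) *m f (drop i w).

Lemma fm_conv_nil t (f : seq 'I_N -> 'M[F]_(s, t)) j :
  fm_conv f j [::] = fm_B a j *m f [::].
Proof. by rewrite /fm_conv big_ord1. Qed.

Lemma fm_conv_cons t (f : seq 'I_N -> 'M[F]_(s, t)) j j' w :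
  fm_conv f j (j' :: w) = fm_B a j *m f (j' :: w) + fm_A a j *m fm_conv f j' w.
Proof.
rewrite /fm_conv big_ord_recl /=; congr (_ + _).
by rewrite mulmx_sumr; apply: eq_bigr => i _; rewrite mulmxA.
Qed.

Lemma fm_coef_conv t (f : seq 'I_N -> 'M[F]_(s, t)) j w :
  \sum_(i < (size (j :: w)).+1) fm_coef (take i (j :: w)) *m f (drop i (j :: w)) =
  fm_D a *m f (j :: w) + fm_C a *m fm_conv f j w.
Proof.
rewrite big_ord_recl /=; congr (_ + _).
by rewrite mulmx_sumr; apply: eq_bigr => i _; rewrite mulmxA.
Qed.

End Node.

(** The iterate expands into coefficients at words of length i + 1; the induction absorbs one factor
    A_k (x) W_k at a time into the output side. *)
Lemma fm_markov p s (a a' : fm_node p s) n (W : 'I_N -> 'M[F]_n) :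
    fm_coef a =1 fm_coef a' -> forall i,
  (fm_C a *t 1%:M) *m iter i (mulmx (tsum (fm_A a) W)) (tsum (fm_B a) W) =
  (fm_C a' *t 1%:M) *m iter i (mulmx (tsum (fm_A a') W)) (tsum (fm_B a') W).
Proof.
move=> aa' i.
have : forall j w, fm_C a *m fm_tail a j w = fm_C a' *m fm_tail a' j w.
  by move=> j w; apply: (aa' (j :: w)).
move: (fm_C a) (fm_C a') (1%:M : 'M[F]_n) => c c'.
elim: i c c' => [|i IHi] c c' V cc' /=.
  rewrite !tens_tsum; apply: eq_tsum => // k; exact: (cc' k [::]).
rewrite !mulmxA !tens_tsum !mulmx_suml; apply: eq_bigr => k _.
by apply: IHi => j w; rewrite -!mulmxA; apply: (cc' k (j :: w)).
Qed.

(** Both resolvents are the same linear combination of the iterates compared in [fm_markov]; no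
    power series is summed, so the point may be far from 0. *)
Lemma fm_eval_eq p s (a a' : fm_node p s) n (W : 'I_N -> 'M[F]_n) :
    fm_coef a =1 fm_coef a' ->
    fm_pencil a W \in unitmx -> fm_pencil a' W \in unitmx ->
  fm_eval a W = fm_eval a' W.
Proof.
move=> aa' ua ua'; rewrite /fm_eval /fm_obs -!lock.
have -> : fm_D a = fm_D a' by apply: (aa' [::]).
have [d [e eE]] := invmx_sub1_common ua ua'.
rewrite -!mulmxA (proj1 (eE _)) (proj2 (eE _)) !mulmx_sumr.
congr (_ + _); apply: eq_bigr => i _; rewrite -!scalemxAr.
by rewrite (fm_markov W aa').
Qed.

Section BlockUpper.
Variables (m1 m2 : nat) (A1 : 'I_N -> 'M[F]_m1) (A12 : 'I_N -> 'M[F]_(m1, m2)).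
Variables (A2 : 'I_N -> 'M[F]_m2) (n : nat) (W : 'I_N -> 'M[F]_n).
Let P := pencil (fun k => block_mx (A1 k) (A12 k) 0 (A2 k)) W.

Lemma pencil_upper_pid1 : P *m (col_mx 1%:M 0 *t 1%:M) =
  (col_mx 1%:M 0 *t 1%:M) *m pencil A1 W.
Proof.
rewrite mulmxBl mulmxBr mul1mx mulmx1 tsum_tens tens_tsum; congr (_ - _).
apply: eq_tsum => k; rewrite ?mulmx1 ?mul1mx //.
by rewrite mul_block_col mul_col_mx !mulmx0 !mulmx1 !mul1mx !mul0mx !addr0.
Qed.

Lemma pencil_upper_pid2 : P *m (col_mx 0 1%:M *t 1%:M) =
  (col_mx 0 1%:M *t 1%:M) *m pencil A2 W - (col_mx 1%:M 0 *t 1%:M) *m tsum A12 W.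
Proof.
rewrite mulmxBl mulmxBr mul1mx mulmx1 tsum_tens !tens_tsum -addrA -opprD.
congr (_ - _); rewrite /tsum -big_split /=; apply: eq_bigr => k _.
rewrite !mul1mx mulmx1 -tensmxDl; congr (_ *t _).
rewrite mul_block_col !mul_col_mx !mulmx0 !mulmx1 !mul1mx !mul0mx.
by rewrite add_col_mx !add0r addr0.
Qed.

Lemma tsum_col s (B1 : 'I_N -> 'M[F]_(m1, s)) (B2 : 'I_N -> 'M[F]_(m2, s)) :
  tsum (fun k => col_mx (B1 k) (B2 k)) W =
  (col_mx 1%:M 0 *t 1%:M) *m tsum B1 W + (col_mx 0 1%:M *t 1%:M) *m tsum B2 W.
Proof.
rewrite !tens_tsum /tsum -big_split /=; apply: eq_bigr => k _.
by rewrite -tensmxDl !mul_col_mx !mul1mx !mul0mx add_col_mx add0r addr0.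
Qed.

Lemma pencil_upper_unit :
  pencil A1 W \in unitmx -> pencil A2 W \in unitmx -> P \in unitmx.
Proof.
move=> u1 u2; apply: row_inj_unitmx => u uP0.
have u10 : u *m (col_mx 1%:M 0 *t 1%:M) = 0 :> 'rV_(m1 * n).
  apply: (row_unitmx0 u1).
  by rewrite -mulmxA -pencil_upper_pid1 mulmxA uP0 mul0mx.
have u20 : u *m (col_mx 0 1%:M *t 1%:M) = 0 :> 'rV_(m2 * n).
  apply: (row_unitmx0 u2); rewrite -mulmxA -[X in _ *m X](subrK
    ((col_mx 1%:M 0 *t 1%:M) *m tsum A12 W)) -pencil_upper_pid2 mulmxDr !mulmxA.
  rewrite uP0 u10.
  by rewrite !mul0mx addr0.
rewrite -[u]mulmx1 -tensmx11.
rewrite -col_row_id tensmxDl mulmxDr.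
have tE p (M : 'M[F]_(m1 + m2, p)) (M' : 'M[F]_(p, m1 + m2)) :
    (M *m M') *t 1%:M = (M *t 1%:M) *m (M' *t 1%:M) :> 'M_(_ * n).
  by rewrite tensmx_mul mulmx1.
by rewrite !tE !mulmxA u10 u20 !mul0mx addr0.
Qed.

End BlockUpper.

Section Closure.
Variables (p s t : nat).

Definition fm_add (a b : fm_node p s) : fm_node p s :=
  FMNode (fun k => block_mx (fm_A a k) 0 0 (fm_A b k))
    (fun k => col_mx (fm_B a k) (fm_B b k))
    (row_mx (fm_C a) (fm_C b)) (fm_D a + fm_D b).

Definition fm_mul (a : fm_node p s) (b : fm_node s t) : fm_node p t :=
  FMNode (fun k => block_mx (fm_A a k) (fm_B a k *m fm_C b) 0 (fm_A b k))
    (fun k => col_mx (fm_B a k *m fm_D b) (fm_B b k))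
    (row_mx (fm_C a) (fm_D a *m fm_C b)) (fm_D a *m fm_D b).

Definition fm_lmul (X : 'M[F]_(t, p)) (a : fm_node p s) : fm_node t s :=
  FMNode (fm_A a) (fm_B a) (X *m fm_C a) (X *m fm_D a).

Definition fm_rmul (a : fm_node p s) (X : 'M[F]_(s, t)) : fm_node p t :=
  FMNode (fm_A a) (fun k => fm_B a k *m X) (fm_C a) (fm_D a *m X).

Lemma fm_coef_add a b w : fm_coef (fm_add a b) w = fm_coef a w + fm_coef b w.
Proof.
case: w => //= j w.
suff -> : fm_tail (fm_add a b) j w = col_mx (fm_tail a j w) (fm_tail b j w).
  by rewrite mul_row_col.
elim: w j => //= j' w IHw j.
by rewrite IHw mul_block_col !mul0mx addr0 add0r.
Qed.

Lemma fm_coef_mul a b w : fm_coef (fm_mul a b) w =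
  \sum_(i < (size w).+1) fm_coef a (take i w) *m fm_coef b (drop i w).
Proof.
case: w => [|j w]; first by rewrite big_ord1.
rewrite fm_coef_conv /=.
suff -> : fm_tail (fm_mul a b) j w =
    col_mx (fm_conv a (fm_coef b) j w) (fm_tail b j w).
  by rewrite mul_row_col addrC mulmxA.
elim: w j => [|j' w IHw] j /=; first by rewrite fm_conv_nil.
by rewrite IHw mul_block_col mul0mx add0r fm_conv_cons addrC mulmxA.
Qed.

Lemma fm_coef_lmul X a w : fm_coef (fm_lmul X a) w = X *m fm_coef a w.
Proof.
by case: w => //= j w; rewrite mulmxA; congr (_ *m _).
Qed.

Lemma fm_coef_rmul a X w : fm_coef (fm_rmul a X) w = fm_coef a w *m X.
Proof.
case: w => //= j w; rewrite -mulmxA; congr (_ *m _).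
by elim: w j => //= j' w IHw j; rewrite IHw mulmxA.
Qed.

Variables (n : nat) (W : 'I_N -> 'M[F]_n).

Lemma fm_eval_add a b :
    fm_pencil a W \in unitmx -> fm_pencil b W \in unitmx ->
  fm_pencil (fm_add a b) W \in unitmx /\
  fm_eval (fm_add a b) W = fm_eval a W + fm_eval b W.
Proof.
move=> ua ub; have uab : fm_pencil (fm_add a b) W \in unitmx.
  exact: pencil_upper_unit.
split=> //.
have oa : fm_obs (fm_add a b) W *m (col_mx 1%:M 0 *t 1%:M) = fm_obs a W.
  apply: fm_obs_unique => //.
  rewrite -mulmxA -(pencil_upper_pid1 _ (fun k => 0) (fm_A b)) mulmxA.
  rewrite fm_obsP // tensmx_mul mulmx1.
  by rewrite mul_row_col mulmx0 mulmx1 addr0.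
have ob : fm_obs (fm_add a b) W *m (col_mx 0 1%:M *t 1%:M) = fm_obs b W.
  apply: fm_obs_unique => //.
  have := pencil_upper_pid2 (fm_A a) (fun k => 0) (fm_A b) W.
  rewrite [tsum (fun _ => 0) _]big1 => [|k _]; last exact: tens0mx.
  rewrite mulmx0 subr0 -mulmxA => <-.
  rewrite mulmxA fm_obsP // tensmx_mul mulmx1.
  by rewrite mul_row_col mulmx0 mulmx1 add0r.
rewrite /fm_eval /= tsum_col mulmxDr !mulmxA oa ob tensmxDl.
by rewrite addrACA.
Qed.

Lemma fm_eval_lmul X a :
  fm_pencil a W \in unitmx ->
  fm_eval (fm_lmul X a) W = (X *t 1%:M) *m fm_eval a W.
Proof.
move=> ua; rewrite /fm_eval mulmxDr tensmx_mul mulmx1 mulmxA.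
congr (_ + _ *m _); apply/esym; apply: fm_obs_unique => //.
by rewrite -mulmxA fm_obsP // tensmx_mul mulmx1.
Qed.

Lemma fm_eval_rmul a X :
  fm_eval (fm_rmul a X) W = fm_eval a W *m (X *t 1%:M).
Proof.
rewrite /fm_eval mulmxDl tensmx_mul mulmx1 -mulmxA tsum_tens /fm_obs -!lock.
congr (_ + _ *m _); apply: eq_tsum => k //=; by rewrite mulmx1.
Qed.

Lemma fm_eval_mul a b :
    fm_pencil a W \in unitmx -> fm_pencil b W \in unitmx ->
  fm_pencil (fm_mul a b) W \in unitmx /\
  fm_eval (fm_mul a b) W = fm_eval a W *m fm_eval b W.
Proof.
move=> ua ub; have uab : fm_pencil (fm_mul a b) W \in unitmx.
  exact: pencil_upper_unit.
split=> //.
have oa : fm_obs (fm_mul a b) W *m (col_mx 1%:M 0 *t 1%:M) = fm_obs a W.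
  apply: fm_obs_unique => //.
  rewrite -mulmxA -(pencil_upper_pid1 _ (fun k => fm_B a k *m fm_C b) (fm_A b)).
  rewrite mulmxA fm_obsP // tensmx_mul mulmx1.
  by rewrite mul_row_col mulmx0 mulmx1 addr0.
have ob : fm_obs (fm_mul a b) W *m (col_mx 0 1%:M *t 1%:M) =
    fm_eval a W *m fm_obs b W.
  rewrite -[LHS](mulmxK ub) -[RHS](mulmxK ub); congr (_ *m _).
  have := pencil_upper_pid2 (fm_A a) (fun k => fm_B a k *m fm_C b) (fm_A b) W.
  move=> /eqP; rewrite eq_sym subr_eq => /eqP pE.
  rewrite -[LHS]mulmxA [X in _ *m X]pE mulmxDr mulmxA fm_obsP //.
  rewrite tensmx_mul mulmx1.
  rewrite mul_row_col mulmx0 mulmx1 add0r mulmxA oa.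
  rewrite -[RHS]mulmxA fm_obsP // /fm_eval mulmxDl tensmx_mul mulmx1.
  rewrite -mulmxA tsum_tens; congr (_ + _ *m _).
  by apply: eq_tsum => k //; rewrite mulmx1.
rewrite {1}/fm_eval /= tsum_col mulmxDr !mulmxA oa ob.
rewrite [fm_eval b W in RHS]/fm_eval mulmxDr mulmxA addrA; congr (_ + _).
rewrite /fm_eval mulmxDl tensmx_mul mulmx1 -mulmxA tsum_tens; congr (_ + _ *m _).
by apply: eq_tsum => k //; rewrite mulmx1.
Qed.

End Closure.
Section Inverse.
Variables (p : nat) (a : fm_node p p).
Hypothesis uD : fm_D a \in unitmx.
Let D' := invmx (fm_D a).

Definition fm_inv : fm_node p p :=
  FMNode (fun k => fm_A a k - fm_B a k *m D' *m fm_C a)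
    (fun k => fm_B a k *m D') (- D' *m fm_C a) D'.

(** The correction - B D^{-1} C of the state matrix feeds the output of the inverse back as input,
    which is the first term in [fm_conv_cons]. *)
Lemma fm_tail_inv j w : fm_tail fm_inv j w = fm_conv a (fm_coef fm_inv) j w.
Proof.
elim: w j => [|j' w IHw] j /=; first by rewrite fm_conv_nil.
rewrite fm_conv_cons -IHw /= mulmxBl addrC; congr (_ + _).
by rewrite !mulNmx mulmxN !mulmxA.
Qed.

Lemma fm_coef_inv w :
  \sum_(i < (size w).+1) fm_coef a (take i w) *m fm_coef fm_inv (drop i w) =
  if w is [::] then 1%:M else 0.
Proof.
case: w => [|j w]; first by rewrite big_ord1 /= mulmxV.
rewrite fm_coef_conv -fm_tail_inv /= !mulNmx mulmxN !mulmxA mulmxV //.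
by rewrite mul1mx addNr.
Qed.

(** The two pencils differ by M d C, which yields c' + c' M d c = - d c; this cancels the cross
    terms of the product. *)
Lemma fm_eval_inv n (W : 'I_N -> 'M[F]_n) :
    fm_pencil a W \in unitmx -> fm_pencil fm_inv W \in unitmx ->
  fm_eval fm_inv W *m fm_eval a W = 1%:M.
Proof.
move=> ua ui; set c := fm_obs a W; set c' := fm_obs fm_inv W.
set M := tsum (fm_B a) W; set d := D' *t (1%:M : 'M_n).
have PE : fm_pencil fm_inv W = fm_pencil a W + M *m d *m (fm_C a *t 1%:M).
  rewrite /fm_pencil /pencil /M !tsum_tens -addrA; congr (_ + _).
  apply: oppr_inj; rewrite opprD !opprK /tsum -sumrB; apply: eq_bigr => k _.
  by rewrite !mulmx1 -tensmxBl.
have cP : c *m fm_pencil a W = fm_C a *t 1%:M by rewrite fm_obsP.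
have c'P : c' *m fm_pencil fm_inv W = - (d *m (fm_C a *t 1%:M)).
  by rewrite fm_obsP // tensmx_mul mulmx1 /= mulNmx tensmxNl.
have c'E : c' + c' *m M *m d *m c = - (d *m c).
  rewrite -[LHS](mulmxK ua) -[RHS](mulmxK ua); congr (_ *m _).
  rewrite mulNmx -[d *m c *m _]mulmxA cP -c'P PE mulmxDl [in RHS]mulmxDr.
  by rewrite -[_ *m c *m _]mulmxA cP !mulmxA.
have -> : fm_eval fm_inv W = d + c' *m M *m d.
  rewrite /fm_eval -mulmxA tsum_tens; congr (_ + _ *m _).
  by apply: eq_tsum => k //; rewrite mulmx1.
have dD : d *m (fm_D a *t 1%:M) = 1%:M.
  by rewrite tensmx_mul mulVmx // mulmx1 tensmx11.
rewrite /fm_eval -/c -/M mulmxDl !mulmxDr dD -[_ *m d *m (_ *t _)]mulmxA dD.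
rewrite mulmx1 !mulmxA; have := congr1 (mulmx^~ M) c'E.
by rewrite mulmxDl mulNmx => ->; rewrite addrK.
Qed.

End Inverse.
End FM.

(** * Realization of rational expressions *)

Section Rational.
Variables (C : numClosedFieldType) (N : nat).

Lemma fps_inverse_unique (g f f' : fps C N) : g [::] != 0 ->
  fps_mul g f =1 fps_mul g f' -> f =1 f'.
Proof.
move=> g0 gf w; have [m] := ubnP (size w); elim: m w => // m IHm w.
rewrite ltnS => le_wm; have := gf w; rewrite /fps_mul !big_ord_recl /=.
rewrite !take0 !drop0 [X in _ + X = _](eq_bigr
  (fun i : 'I_(size w) => g (take (bump 0 i) w) * f' (drop (bump 0 i) w))).
  by move/addIr/(mulfI g0).
move=> i _; rewrite IHm // size_drop; apply: leq_trans le_wm.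
by rewrite /bump add1n ltn_subrL /= (leq_ltn_trans _ (ltn_ord i)).
Qed.

Lemma tens1mx_eq0 m n p (X : 'M[C]_(m, n)) : (0 < p)%N ->
  (1%:M : 'M[C]_p) *t X = 0 -> X = 0.
Proof.
case: p => // p _ X0; apply/matrixP => i j.
have /matrixP/(_ (mxtens_index (ord0, i)) (mxtens_index (ord0, j))) := X0.
by rewrite tensmxE !mxE mul1r.
Qed.

(** The invariant of the induction on expressions: one node carries the series and, generically, the
    values of the expression. The factor [1%:M] adapts the size [n] to [1 * n]. *)
Definition fm_rexpr (e : rexpr C N) (f : fps C N) :=
  exists (a : fm_node C N 1 1) (Q : tuple_pred C N),
    [/\ regular Q, forall w, fm_coef a w = (f w)%:M &
      forall n (W : 'I_N -> 'M[C]_n), Q n W -> fm_pencil a W \in unitmx /\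
        exists2 v, rexpr_eval W e = Some v & fm_eval a W = 1%:M *t v].

Lemma fm_rexpr_const c f : f =1 @fps_const C N c -> fm_rexpr (@RConst C N c) f.
Proof.
move=> fE; pose a : fm_node C N 1 1 :=
  @FMNode _ _ _ _ 1 (fun=> 0) (fun=> 0) 0 c%:M.
exists a, (fun n W => fm_pencil a W \in unitmx); split.
- exact: regular_pencil.
- by move=> [|j w]; rewrite fE //= mul0mx raddf0.
move=> n W ua; split=> //; exists c%:M => //.
rewrite /fm_eval /fm_obs -lock /= tens0mx !mul0mx addr0.
have S m : (c%:M : 'M[C]_m) = c *: 1%:M by rewrite scalemx1.
by rewrite (S 1) (S n) tensmxZl tensmxZr.
Qed.

Lemma fm_rexpr_var k f : f =1 @fps_var C N k -> fm_rexpr (@RVar C N k) f.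
Proof.
move=> fE; pose a : fm_node C N 1 1 :=
  @FMNode _ _ _ _ 1 (fun=> 0) (fun j => (j == k)%:R%:M) 1%:M 0.
exists a, (fun n W => fm_pencil a W \in unitmx); split.
- exact: regular_pencil.
- move=> [|j [|j' w]]; rewrite fE /= ?raddf0 ?mul1mx ?mul0mx //.
    by rewrite /fps_var eqseq_cons andbT.
  by rewrite /fps_var eqseq_cons andbF raddf0.
move=> n W ua; split=> //; exists (W k) => //.
have P1 : fm_pencil a W = 1%:M.
  by rewrite /fm_pencil /pencil /tsum big1 ?subr0 // => j _; rewrite tens0mx.
rewrite /fm_eval /fm_obs -lock P1 invmx1 mulmx1 /= tensmx11 tens0mx add0r mul1mx.
rewrite /tsum (bigD1 k) //= big1 => [|j /negPf ->]; first by rewrite eqxx addr0.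
by rewrite raddf0 tens0mx.
Qed.

Lemma fm_rexpr_add e1 e2 f1 f2 f : fm_rexpr e1 f1 -> fm_rexpr e2 f2 ->
  f =1 fps_add f1 f2 -> fm_rexpr (RAdd e1 e2) f.
Proof.
move=> [a1 [Q1 [reg1 c1 ev1]]] [a2 [Q2 [reg2 c2 ev2]]] fE.
exists (fm_add a1 a2), (fun n W => Q1 n W /\ Q2 n W); split.
- exact: regularI.
- by move=> w; rewrite fm_coef_add c1 c2 fE raddfD.
move=> n W [/ev1[u1 [v1 e1E t1]] /ev2[u2 [v2 e2E t2]]].
have [u tE] := fm_eval_add u1 u2; split=> //.
by exists (v1 + v2); rewrite /= ?e1E ?e2E // tE t1 t2 tensmxDr.
Qed.

Lemma fm_rexpr_mul e1 e2 f1 f2 f : fm_rexpr e1 f1 -> fm_rexpr e2 f2 ->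
  f =1 fps_mul f1 f2 -> fm_rexpr (RMul e1 e2) f.
Proof.
move=> [a1 [Q1 [reg1 c1 ev1]]] [a2 [Q2 [reg2 c2 ev2]]] fE.
exists (fm_mul a1 a2), (fun n W => Q1 n W /\ Q2 n W); split.
- exact: regularI.
- move=> w; rewrite fm_coef_mul fE raddf_sum; apply: eq_bigr => i _.
  by rewrite c1 c2 -scalar_mxM.
move=> n W [/ev1[u1 [v1 e1E t1]] /ev2[u2 [v2 e2E t2]]].
have [u tE] := fm_eval_mul u1 u2; split=> //.
by exists (v1 *m v2); rewrite /= ?e1E ?e2E // tE t1 t2 tensmx_mul mulmx1.
Qed.

(** Where the pencil of the inverse node is invertible too, [fm_eval_inv] inverts the value of [e],
    so the inversion in the expression is possible. *)
Lemma fm_rexpr_inv e g f : fm_rexpr e g -> g [::] != 0 ->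
  fps_mul g f =1 @fps_const C N 1 -> fm_rexpr (RInv e) f.
Proof.
move=> [a [Q [reg ca ev]]] g0 gf.
have uD : fm_D a \in unitmx.
  by rewrite -[fm_D a]/(fm_coef a [::]) ca unitmxE det_scalar1 unitfE.
exists (fm_inv a), (fun n W => Q n W /\ fm_pencil (fm_inv a) W \in unitmx); split.
- by apply: regularI => //; apply: regular_pencil.
- pose f' w := fm_coef (fm_inv a) w 0 0.
  have f'E w : fm_coef (fm_inv a) w = (f' w)%:M by rewrite [LHS]mx11_scalar.
  move=> w; rewrite f'E; congr _%:M; move: w; apply: (fps_inverse_unique g0) => w.
  rewrite gf; have /matrixP/(_ 0 0) := fm_coef_inv uD w.
  rewrite summxE => aE.
  transitivity ((if w is [::] then 1%:M else 0 : 'M[C]_1) 0 0).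
    by rewrite -aE; apply: eq_bigr => i _; rewrite ca f'E -scalar_mxM mxE mulr1n.
  by case: w {aE} => [|j w]; rewrite mxE.
move=> n W [/ev[u [v eE tE]] ui]; split=> //.
have TT := fm_eval_inv uD u ui; rewrite tE in TT.
have uv : v \in unitmx.
  apply: row_inj_unitmx => x xv0; apply: (@tens1mx_eq0 _ _ 1) => //.
  have := mulmx1C TT => VT.
  rewrite -[LHS]mulmx1 -VT mulmxA tensmx_mul xv0 tensmx0 mul0mx //.
exists (invmx v); first by rewrite /= eE uv.
rewrite -[LHS]mulmx1 -[X in _ *m X]tensmx11 -(mulmxV uv) -(mulmx1 1%:M).
by rewrite -tensmx_mul mulmxA TT mul1mx mulmx1.
Qed.

Lemma rational_fm e f : rexpr_represents e f -> fm_rexpr e f.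
Proof.
elim: e f => [c|k|e1 IH1 e2 IH2|e1 IH1 e2 IH2|e IH] f /=.
- exact: fm_rexpr_const.
- exact: fm_rexpr_var.
- by move=> [f1 [f2 [/IH1 ? /IH2 ?]]]; apply: fm_rexpr_add.
- by move=> [f1 [f2 [/IH1 ? /IH2 ?]]]; apply: fm_rexpr_mul.
by move=> [g [/IH ? g0 gf _]]; apply: fm_rexpr_inv gf.
Qed.

Variable q : nat.

Lemma matrix_rational_fm (f : mxfps C N q) : mxfps_rational f ->
  exists (a : fm_node C N q q) (Q : tuple_pred C N),
    [/\ regular Q, fm_coef a =1 f &
      forall n (W : 'I_N -> 'M[C]_n), Q n W -> fm_pencil a W \in unitmx /\
        mxfps_value f W (fm_eval a W)].
Proof.
move=> frat.
have /fin_all_exists[E] : forall ij : 'I_q * 'I_q, exists e,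
  rexpr_represents e (fun w => f w ij.1 ij.2) by move=> ij; apply: frat.
move=> EE.
have /fin_all_exists[a] : forall ij, _ := fun ij => rational_fm (EE ij).
case/fin_all_exists => Q aQ.
pose v n (W : 'I_N -> 'M[C]_n) ij := odflt 0 (rexpr_eval W (E ij)).
have vE n (W : 'I_N -> 'M[C]_n) ij : Q ij n W ->
    rexpr_eval W (E ij) = Some (v n W ij).
  by case: (aQ ij) => _ _ ev /ev[_ [u uE _]]; rewrite /v uE.
pose b (ij : 'I_q * 'I_q) :=
  fm_rmul (fm_lmul (delta_mx ij.1 0) (a ij)) (delta_mx 0 ij.2).
have [c [cE cev]] : exists c : fm_node C N q q,
    (forall w, fm_coef c w = \sum_ij fm_coef (b ij) w) /\
    forall n (W : 'I_N -> 'M[C]_n), (forall ij, Q ij n W) ->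
      fm_pencil c W \in unitmx /\ fm_eval c W = \sum_ij fm_eval (b ij) W.
  pose zero : fm_node C N q q := @FMNode _ _ _ _ 0 (fun=> 0) (fun=> 0) 0 0.
  elim: (index_enum _) => [|ij s [c [cE cev]]].
    exists zero; split=> [w|n W _].
      by rewrite big_nil; case: w => //= j w; rewrite mul0mx.
    split; first by apply: row_inj_unitmx => u _; apply/rowP => -[].
    by rewrite big_nil /fm_eval /fm_obs -lock /= !tens0mx !mul0mx addr0.
  exists (fm_add (b ij) c); split=> [w|n W QW].
    by rewrite fm_coef_add cE big_cons.
  have [uc ecE] := cev n W QW.
  have ub : fm_pencil (b ij) W \in unitmx.
    by case: (aQ ij) => _ _ /(_ _ _ (QW ij))[].
  by have [u ->] := fm_eval_add ub uc; rewrite big_cons ecE.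
exists c, (fun n W => forall ij, Q ij n W); split.
- by apply: regular_forall => ij; case: (aQ ij).
- move=> w; rewrite cE [RHS]matrix_sum_delta pair_bigA.
  apply: eq_bigr => -[i j] _.
  rewrite /b fm_coef_rmul fm_coef_lmul; case: (aQ (i, j)) => _ -> _ /=.
  by rewrite mul_mx_scalar -scalemxAl mul_delta_mx.
move=> n W QW; have [uc ->] := cev n W QW; split=> //.
exists (fun i j => E (i, j)), (fun i j => v n W (i, j)); split.
- by move=> i j; apply: (EE (i, j)).
- by move=> i j; apply: vE.
rewrite pair_bigA; apply: eq_bigr => -[i j] _.
have [_ _ /(_ _ _ (QW (i, j)))[ua [u uE tE]]] := aQ (i, j).
rewrite /b fm_eval_rmul fm_eval_lmul // tE /v uE /= !tensmx_mul.
by rewrite mul1mx mulmx1 mulmx1 mul_delta_mx.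
Qed.

End Rational.

(** * From Fornasini-Marchesini nodes to GR-nodes *)

Section ToGR.
Variables (C : numClosedFieldType) (N q : nat).

(** Every block of the state space is a copy of C^(dim + q): the upper part stores a state, the
    lower part an input, and the row [A_k B_k] reads both. *)
Lemma fm_to_GR (a : fm_node C N q q) :
  exists (r : 'I_N -> nat) (alpha : GR_node C q r),
    GR_transfer alpha =1 fm_coef a.
Proof.
pose m := (fm_dim a + q)%N; pose r (k : 'I_N) := m.
pose E k : 'M[C]_(fm_dim a, m) := row_mx (fm_A a k) (fm_B a k).
pose alpha : GR_node C q r := GRNode
  (\mxblock_(i, j) (col_mx 1%:M 0 *m E j))
  (\mxcol_i col_mx 0 1%:M) (\mxrow_j (fm_C a *m E j)) (fm_D a).
exists r, alpha => -[|j w] //=.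
have tE i w' : E i *m GR_tail alpha w' i = fm_tail a i w'.
  elim: w' i => [|i' w' IHw] i /=.
    by rewrite mxcolK mul_row_col mulmx0 mulmx1 add0r.
  by rewrite mxblockK -!mulmxA IHw mulmxA mul_row_col mulmx0 mulmx1 addr0.
by rewrite mxrowK -mulmxA tE.
Qed.

End ToGR.

(** * Minimal GR-realizations *)

Section FiniteSpan.
Variables (F : fieldType) (T : Type) (m n : nat) (G : T -> 'M[F]_(m, n)).

(** Members outside the current span are added one by one; each raises the rank, which is at most
    [n]. *)
Lemma finite_span : exists d (u : 'I_d -> T),
  forall t, (G t <= \sum_i <<G (u i)>>)%MS.
Proof.
suff IH e : forall d (u : 'I_d -> T),
    (n - \rank (\sum_i <<G (u i)>>)%MS < e)%N ->
    exists d (u : 'I_d -> T), forall t, (G t <= \sum_i <<G (u i)>>)%MS.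
  (* The family starts empty: an index in ['I_0] carries a false inequality, which the matches
     eliminate. *)
  apply: (IH n.+1 0%N (fun i : 'I_0 => match i with Ordinal _ h => match
    Bool.diff_false_true h with end end)).
  by rewrite ltnS leq_subr.
elim: e => // e IHe d u lt_e; apply: contrapT => nex.
have [t nt] : exists t, ~~ (G t <= \sum_i <<G (u i)>>)%MS.
  apply: contrapT => nt; apply: nex; exists d, u => t.
  by apply: contraT => Gt; case: nt; exists t.
apply: nex.
apply: (IHe d.+1 (fun i => if unlift ord0 i is Some j then u j else t)).
rewrite big_ord_recl unlift_none.
under eq_bigr => i _ do rewrite liftK.
set V := (\sum_i <<G (u i)>>)%MS in nt lt_e *.
have lt_V : (\rank V < \rank (<<G t>> + V)%MS)%N.
  apply: rank_ltmx; rewrite ltmxE addsmxSr /=.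
  apply: contra nt; apply: submx_trans.
  by apply: submx_trans (addsmxSl _ _); rewrite genmxE.
rewrite ltnS in lt_e; apply: leq_trans lt_e; rewrite ltn_sub2l //.
exact: leq_trans lt_V (rank_leq_col _).
Qed.

Lemma finite_left_inverse :
    (forall v : 'cV_n, (forall t, G t *m v = 0) -> v = 0) ->
  exists d (u : 'I_d -> T) (X : 'I_d -> 'M_(n, m)), \sum_i X i *m G (u i) = 1%:M.
Proof.
move=> G0; have [d [u uG]] := finite_span; exists d, u.
suff /sub_sums_genmxP[X XE] : (1%:M <= \sum_i <<G (u i)>>)%MS by exists X.
rewrite submxE mul1mx; apply/eqP/matrixP => i j; rewrite [RHS]mxE.
suff /colP/(_ i) : col j (cokermx (\sum_i <<G (u i)>>)%MS) = 0 by rewrite !mxE.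
apply: G0 => t; have /submxP[Y ->] := uG t.
by rewrite colE -mulmxA [X in _ *m X]mulmxA mulmx_coker mul0mx mulmx0.
Qed.

End FiniteSpan.

Section GRNodes.
Variables (C : numClosedFieldType) (N q : nat).

Section Node.
Variables (r : 'I_N -> nat) (alpha : GR_node C q r).

(* The coefficients C_{j_1} A_{j_1 j_2} ... A_{j_m k}; the word is reversed. *)
Fixpoint GR_head (u : seq 'I_N) (k : 'I_N) : 'M[C]_(q, r k) :=
  if u is i :: u' then GR_head u' i *m submxblock (GR_A alpha) i k
  else submxrow (GR_C alpha) k.

Lemma GR_transfer_cat u k v :
  GR_transfer alpha (rev u ++ k :: v) = GR_head u k *m GR_tail alpha v k.
Proof.
elim: u k v => [|i u IHu] k v //.
by rewrite rev_cons cat_rcons IHu /= mulmxA.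
Qed.

Definition controllable := forall k (l : 'rV_(r k)),
  (forall w, l *m GR_tail alpha w k = 0) -> l = 0.

Definition observable := forall k (v : 'cV_(r k)),
  (forall u, GR_head u k *m v = 0) -> v = 0.

Lemma controllable_mx : controllable -> forall k m (M M' : 'M_(m, r k)),
  (forall w, M *m GR_tail alpha w k = M' *m GR_tail alpha w k) -> M = M'.
Proof.
move=> ctr k m M M' MM'; apply/eqP; rewrite -subr_eq0; apply/eqP/row_matrixP => i.
rewrite row0; apply: ctr => w; rewrite -row_mul mulmxBl MM' subrr.
exact: row0.
Qed.

End Node.

(** The stacked heads of [alpha] have a left inverse; applied to the heads of [beta] it gives [X],
    since head times tail is a coefficient of the common series. *)
Lemma observable_map r s (alpha : GR_node C q r) (beta : GR_node C q s) :
    observable alpha -> GR_transfer alpha =1 GR_transfer beta ->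
  exists X : forall k, 'M_(r k, s k),
    forall k w, GR_tail alpha w k = X k *m GR_tail beta w k.
Proof.
move=> obs ab; apply: (@fin_all_exists _ (fun k => 'M_(r k, s k)) (fun k X =>
  forall w, GR_tail alpha w k = X *m GR_tail beta w k)) => k.
have [d [u [X XE]]] := finite_left_inverse (obs k).
exists (\sum_i X i *m GR_head beta (u i) k) => w.
rewrite -[LHS]mul1mx -XE !mulmx_suml; apply: eq_bigr => i _.
by rewrite -!mulmxA -!GR_transfer_cat ab.
Qed.

Lemma controllable_right_inverse r (alpha : GR_node C q r) k :
  controllable alpha -> exists d (w : 'I_d -> seq 'I_N) (Y : 'I_d -> 'M_(q, r k)),
    \sum_i GR_tail alpha (w i) k *m Y i = 1%:M.
Proof.
move=> ctr; have [v|d [w [Y YE]]] := @finite_left_inverse _ _ _ _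
    (fun w => (GR_tail alpha w k)^T).
  move=> v0; apply: trmx_inj; rewrite trmx0; apply: ctr => w.
  by apply: trmx_inj; rewrite trmx_mul trmxK v0 trmx0.
exists d, w, (fun i => (Y i)^T); apply: trmx_inj.
rewrite trmx1 -YE linear_sum; apply: eq_bigr => i _.
by rewrite /= trmx_mul trmxK.
Qed.

(** The identity of size [r k] factors through size [s k], by [observable_map] and a right inverse
    of the tails. *)
Lemma ctr_obs_minimal r (alpha : GR_node C q r) f :
    controllable alpha -> observable alpha -> GR_realization alpha f ->
  GR_minimal_realization alpha f.
Proof.
move=> ctr obs af; split=> // s beta bf k.
have [|X XE] := observable_map obs (_ : GR_transfer alpha =1 GR_transfer beta).
  by move=> w; rewrite af bf.
have [d [w [Y YE]]] := controllable_right_inverse k ctr.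
apply: (@mulmx1_min _ _ _ (X k) (\sum_i GR_tail beta (w i) k *m Y i)).
by rewrite mulmx_sumr -YE; apply: eq_bigr => i _; rewrite mulmxA -XE.
Qed.

(** Compression to the spans of the tails, which A maps into one another. If no dimension drops, the
    tails span everything. *)
Lemma reduce_ctr r (alpha : GR_node C q r) :
  exists (s : 'I_N -> nat) (beta : GR_node C q s),
  [/\ GR_transfer beta =1 GR_transfer alpha,
    forall k, (s k <= r k)%N &
    (forall k, (r k <= s k)%N) -> controllable alpha].
Proof.
pose G k w := (GR_tail alpha w k)^T.
have /(@fin_all_exists _ (fun k => 'M[C]_(r k)))[V VP] k : exists V : 'M[C]_(r k),
    (forall w, (G k w <= V)%MS) /\
    exists d (u : 'I_d -> _), V = (\sum_i <<G k (u i)>>)%MS.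
  have [d [u uG]] := finite_span (G k).
  by exists (\sum_i <<G k (u i)>>)%MS; split=> //; exists d, u.
pose s k := \rank (V k); pose R k : 'M_(r k, s k) := (row_base (V k))^T.
have RV k m (M : 'M_(r k, m)) : (M^T <= V k)%MS -> exists Y, M = R k *m Y.
  rewrite -(eq_row_base (V k)) => /submxP[Y ME]; exists Y^T.
  by rewrite /R -trmx_mul -ME trmxK.
have /(@fin_all_exists _ (fun k => 'M_(s k, q)))[B' BE] k :
    exists Y, submxcol (GR_B alpha) k = R k *m Y.
  by apply: RV; have [/(_ [::])] := VP k.
have ex_A i j : exists Y, submxblock (GR_A alpha) i j *m R j = R i *m Y.
  apply: RV; rewrite trmx_mul trmxK.
  have [_ [d [u uE]]] := VP j.
  have : (row_base (V j) <= \sum_i <<G j (u i)>>)%MS by rewrite eq_row_base uE.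
  case/sub_sums_genmxP => Y ->; rewrite mulmx_suml; apply: summx_sub => l _.
  rewrite -mulmxA -trmx_mul mulmx_sub //.
  by have [/(_ (j :: u l))] := VP i.
have /fin_all_exists[A' AE] i := @fin_all_exists _ _ _ (ex_A i).
pose beta : GR_node C q s := GRNode (\mxblock_(i, j) A' i j) (\mxcol_i B' i)
  (\mxrow_j (submxrow (GR_C alpha) j *m R j)) (GR_D alpha).
have tE w k : GR_tail alpha w k = R k *m GR_tail beta w k.
  elim: w k => [|j w IHw] k /=; first by rewrite mxcolK BE.
  by rewrite mxblockK IHw mulmxA AE mulmxA.
exists s, beta; split.
- by case=> [|j w] //=; rewrite mxrowK -mulmxA -tE.
- by move=> k; apply: rank_leq_col.
move=> rs k l l0; have [_ [d [u uE]]] := VP k.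
have : row_full (V k) by rewrite /row_full eqn_leq rank_leq_col rs.
rewrite -sub1mx uE => /sub_sums_genmxP[Y YE].
apply: trmx_inj; rewrite trmx0 -[LHS]mul1mx YE mulmx_suml big1 // => i _.
by rewrite -mulmxA -trmx_mul l0 trmx0 mulmx0.
Qed.

(** The dual compression: the heads factor through a basis of their row space, so that unobservable
    states are divided out. *)
Lemma reduce_obs r (alpha : GR_node C q r) :
  exists (s : 'I_N -> nat) (beta : GR_node C q s),
  [/\ GR_transfer beta =1 GR_transfer alpha,
    forall k, (s k <= r k)%N &
    (forall k, (r k <= s k)%N) -> observable alpha].
Proof.
have /(@fin_all_exists _ (fun k => 'M[C]_(r k)))[V VP] k : exists V : 'M[C]_(r k),
    (forall w, (GR_head alpha w k <= V)%MS) /\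
    exists d (u : 'I_d -> _), V = (\sum_i <<GR_head alpha (u i) k>>)%MS.
  have [d [u uG]] := finite_span (fun w => GR_head alpha w k).
  by exists (\sum_i <<GR_head alpha (u i) k>>)%MS; split=> //; exists d, u.
pose s k := \rank (V k); pose R k : 'M_(s k, r k) := row_base (V k).
have RV k m (M : 'M_(m, r k)) : (M <= V k)%MS -> exists Y, M = Y *m R k.
  by rewrite -(eq_row_base (V k)) => /submxP.
have /(@fin_all_exists _ (fun k => 'M_(q, s k)))[C' CE] k :
    exists Y, submxrow (GR_C alpha) k = Y *m R k.
  by apply: RV; have [/(_ [::])] := VP k.
have ex_A i j : exists Y, R i *m submxblock (GR_A alpha) i j = Y *m R j.
  apply: RV; have [_ [d [u uE]]] := VP i.
  have : (R i <= \sum_l <<GR_head alpha (u l) i>>)%MS by rewrite eq_row_base uE.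
  case/sub_sums_genmxP => Y ->; rewrite mulmx_suml; apply: summx_sub => l _.
  rewrite -mulmxA mulmx_sub //.
  by have [/(_ (i :: u l))] := VP j.
have /fin_all_exists[A' AE] i := @fin_all_exists _ _ _ (ex_A i).
pose beta : GR_node C q s := GRNode (\mxblock_(i, j) A' i j)
  (\mxcol_i (R i *m submxcol (GR_B alpha) i)) (\mxrow_j C' j) (GR_D alpha).
have tE w k : GR_tail beta w k = R k *m GR_tail alpha w k.
  elim: w k => [|j w IHw] k /=; first by rewrite mxcolK.
  by rewrite mxblockK IHw mulmxA [RHS]mulmxA AE.
exists s, beta; split.
- by case=> [|j w] //=; rewrite mxrowK tE mulmxA -CE.
- by move=> k; apply: rank_leq_col.
move=> rs k l l0; have [_ [d [u uE]]] := VP k.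
have : row_full (V k) by rewrite /row_full eqn_leq rank_leq_col rs.
rewrite -sub1mx uE => /sub_sums_genmxP[Y YE].
rewrite -[LHS]mul1mx YE mulmx_suml big1 // => i _.
by rewrite -mulmxA l0 mulmx0.
Qed.

Lemma minimal_ctr_obs r (alpha : GR_node C q r) f :
  GR_minimal_realization alpha f -> controllable alpha /\ observable alpha.
Proof.
move=> [af amin]; split.
  have [s [beta [ba _]]] := reduce_ctr alpha; apply; apply: (amin s beta).
  by move=> w; rewrite ba af.
have [s [beta [ba _]]] := reduce_obs alpha; apply; apply: (amin s beta).
by move=> w; rewrite ba af.
Qed.

(** Neither reduction can shrink a block of a realization of least total dimension, which is
    therefore controllable and observable, hence minimal in each block separately. *)
Lemma minimal_exists r (alpha : GR_node C q r) :
  exists (s : 'I_N -> nat) (beta : GR_node C q s),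
    GR_minimal_realization beta (GR_transfer alpha).
Proof.
pose P n := exists (s : 'I_N -> nat) (beta : GR_node C q s),
  GR_transfer beta =1 GR_transfer alpha /\ (\sum_k s k)%N = n.
have exP : exists n, `[< P n >].
  by exists (\sum_k r k)%N; apply/asboolP; exists r, alpha.
case: (ex_minnP exP) => n /asboolP[s [beta [ba sn]]] nmin.
have smin t (gamma : GR_node C q t) : GR_transfer gamma =1 GR_transfer beta ->
    (forall k, (t k <= s k)%N) -> forall k, (s k <= t k)%N.
  move=> gb ts k; rewrite leqNgt; apply/negP => lt_ts.
  have : (n <= \sum_k t k)%N.
    by apply: nmin; apply/asboolP; exists t, gamma; split=> // w; rewrite gb.
  rewrite leqNgt -sn (bigD1 k) //= [X in (_ < X)%N](bigD1 k) //= -addSn.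
  rewrite leq_add //.
  by apply: leq_sum => j _.
exists s, beta; apply: ctr_obs_minimal => //.
  have [t [gamma [gb ts]]] := reduce_ctr beta; apply; exact: smin gb ts.
have [t [gamma [gb ts]]] := reduce_obs beta; apply; exact: smin gb ts.
Qed.

(** Observability of each node gives maps in both directions; controllability reduces their
    invertibility and the intertwining relations to identities on tails. *)
Lemma minimal_similar (r : 'I_N -> nat) (a1 a2 : GR_node C q r) f :
    GR_minimal_realization a1 f -> GR_minimal_realization a2 f ->
  exists T : forall k, 'M[C]_(r k), [/\ forall k, T k \in unitmx,
    forall i j : 'I_N,
      T i *m submxblock (GR_A a1) i j = submxblock (GR_A a2) i j *m T j,
    forall i : 'I_N, T i *m submxcol (GR_B a1) i = submxcol (GR_B a2) i &
    forall j : 'I_N, submxrow (GR_C a1) j = submxrow (GR_C a2) j *m T j].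
Proof.
move=> m1 m2.
have [c1 o1] := minimal_ctr_obs m1; have [c2 o2] := minimal_ctr_obs m2.
have E12 : GR_transfer a1 =1 GR_transfer a2.
  by move=> w; rewrite (proj1 m1) (proj1 m2).
have [X XE] := observable_map o1 E12.
have [T TE] := observable_map o2 (fsym E12).
exists T; split.
- move=> k; suff /mulmx1_unit[] : T k *m X k = 1%:M by [].
  apply: (controllable_mx c2) => w; rewrite -mulmxA -XE -TE mul1mx //.
- move=> i j; apply: (controllable_mx c1) => w.
  by rewrite -[RHS]mulmxA -TE -mulmxA -(TE i (j :: w)).
- by move=> i; rewrite -(TE i [::]).
move=> j; apply: (controllable_mx c1) => w.
by rewrite -mulmxA -TE; apply: (E12 (j :: w)).
Qed.

End GRNodes.

(** * Projections onto the summands of the state space *)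

Section BlockProjections.
Variables (C : numClosedFieldType) (N : nat) (r : 'I_N -> nat).
Local Notation R := (\sum_k r k)%N.

Definition bproj (k : 'I_N) : 'M[C]_(r k, R) := submxcol 1%:M k.

Lemma submxcol_bproj n (M : 'M[C]_(R, n)) k : submxcol M k = bproj k *m M.
Proof. by rewrite submxcol_mul mul1mx. Qed.

Lemma submxrow_bproj m (M : 'M[C]_(m, R)) k : submxrow M k = M *m (bproj k)^T.
Proof. by rewrite tr_submxcol mul_submxrow trmx1 mulmx1. Qed.

Lemma submxblock_bproj (M : 'M[C]_R) i j :
  submxblock M i j = bproj i *m M *m (bproj j)^T.
Proof. by rewrite submxblockEh submxcol_bproj submxrow_bproj mulmxA. Qed.

Lemma bproj_mxdiag (S : forall k, 'M[C]_(r k)) k :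
  bproj k *m (\mxdiag_j S j) = S k *m bproj k.
Proof.
rewrite submxcol_mul mul1mx -[\mxdiag_j S j]mulmx1 -{1}(submxcolK 1%:M).
by rewrite mul_mxdiag_mxcol mxcolK.
Qed.

Lemma bprojK k : bproj k *m (bproj k)^T = 1%:M.
Proof.
rewrite -[X in X *m _]mulmx1 -submxblock_bproj -(mxdiagZ 1).
by rewrite submxblock_diag.
Qed.

Lemma bproj_ortho i j : i != j -> bproj i *m (bproj j)^T = 0.
Proof.
move=> ij; rewrite -[X in X *m _]mulmx1 -submxblock_bproj -(mxdiagZ 1).
by rewrite mxblockK (negPf ij).
Qed.

Lemma sum_bproj : \sum_k (bproj k)^T *m bproj k = 1%:M.
Proof.
have -> : 1%:M = (\mxrow_k (submxrow 1%:M k)) *m (\mxcol_k (submxcol 1%:M k))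
    :> 'M[C]_R by rewrite submxrowK submxcolK mulmx1.
rewrite mul_mxrow_mxcol.
by apply: eq_bigr => k _; rewrite submxrow_bproj mul1mx.
Qed.

Lemma bprojC k : (bproj k) ^t* = (bproj k)^T.
Proof. by apply/matrixP => i j; rewrite !mxE rmorph_nat. Qed.

Definition blk k : 'M[C]_R := (bproj k)^T *m bproj k.

Lemma blkC k : (blk k) ^t* = blk k.
Proof. by rewrite trmxC_mul bprojC -map_trmx bprojC trmxK. Qed.

Lemma blkM j k : blk j *m blk k = (j == k)%:R *: blk k.
Proof.
rewrite /blk !mulmxA -[_ *m bproj j *m _]mulmxA; case: eqVneq => [->|jk].
  by rewrite bprojK mulmx1 scale1r.
by rewrite bproj_ortho // mulmx0 mul0mx scale0r.
Qed.

Lemma sum_blk : \sum_k blk k = 1%:M.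
Proof. exact: sum_bproj. Qed.

Lemma bproj_blk k : bproj k *m blk k = bproj k.
Proof. by rewrite mulmxA bprojK mul1mx. Qed.

Lemma mxdiag_of_comm G : (forall k, blk k *m G = G *m blk k) ->
  G = \mxdiag_k (bproj k *m G *m (bproj k)^T).
Proof.
move=> bG; rewrite -[LHS]mul1mx -[RHS]mul1mx -sum_bproj !mulmx_suml.
apply: eq_bigr => k _; rewrite -!mulmxA bproj_mxdiag; congr (_ *m _).
by rewrite -!mulmxA -/(blk k) -bG [RHS]mulmxA bproj_blk.
Qed.

End BlockProjections.

Arguments bproj {C N r}.
Arguments blk {C N r}.

(** * GR-nodes as Fornasini-Marchesini nodes *)

Section Bridge.
Variables (C : numClosedFieldType) (N q : nat) (r : 'I_N -> nat).
Variable alpha : GR_node C q r.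
Local Notation A := (GR_A alpha).
Local Notation B := (GR_B alpha).
Local Notation K := (GR_C alpha).
Local Notation D := (GR_D alpha).

Definition GR_fm : fm_node C N q q :=
  FMNode (fun k => blk k *m A) (fun k => blk k *m B) K D.

Lemma fm_tail_GR j w : fm_tail GR_fm j w = (bproj j)^T *m GR_tail alpha w j.
Proof.
elim: w j => [|i w IHw] j /=; first by rewrite submxcol_bproj mulmxA.
by rewrite IHw submxblock_bproj /blk !mulmxA.
Qed.

Lemma fm_coef_GR : fm_coef GR_fm =1 GR_transfer alpha.
Proof. by case=> [|j w] //=; rewrite fm_tail_GR submxrow_bproj mulmxA. Qed.

Lemma GR_tail_word w k : exists w' j, (bproj k)^T *m GR_tail alpha w k =
  mxword (fun k => blk k *m A) w' *m (blk j *m B).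
Proof.
rewrite -fm_tail_GR; elim: w k => [|i w IHw] k /=.
  by exists [::], k; rewrite mul1mx.
have [w' [j ->]] := IHw i.
by exists (k :: w'), j; rewrite /= !mulmxA.
Qed.

Lemma GR_head_word u k : exists w, GR_head alpha u k *m bproj k =
  K *m mxword (fun k => blk k *m A) w *m blk k.
Proof.
elim: u k => [|i u IHu] k /=.
  by exists [::]; rewrite mulmx1 submxrow_bproj -mulmxA.
have [w wE] := IHu i; exists (rcons w i).
transitivity (GR_head alpha u i *m bproj i *m A *m blk k).
  by rewrite submxblock_bproj /blk !mulmxA.
by rewrite wE mxword_rcons !mulmxA.
Qed.

Lemma controllable_blk : controllable alpha -> forall k (l : 'rV_(\sum_k r k)),
  (forall w j,
     l *m blk k *m mxword (fun k => blk k *m A) w *m (blk j *m B) = 0) ->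
  l *m blk k = 0.
Proof.
move=> ctr k l l0; rewrite /blk mulmxA.
suff -> : l *m (bproj k)^T = 0 by rewrite mul0mx.
apply: ctr => w; have [w' [j E]] := GR_tail_word w k.
have -> : l *m (bproj k)^T *m GR_tail alpha w k =
    l *m blk k *m ((bproj k)^T *m GR_tail alpha w k).
  by rewrite /blk -!mulmxA [bproj k *m (_ *m _)]mulmxA bprojK mul1mx.
by rewrite E mulmxA l0.
Qed.

Lemma observable_blk : observable alpha -> forall k (v : 'cV_(\sum_k r k)),
  (forall w, K *m mxword (fun k => blk k *m A) w *m blk k *m v = 0) ->
  blk k *m v = 0.
Proof.
move=> obs k v v0; rewrite /blk -mulmxA.
suff -> : bproj k *m v = 0 by rewrite mulmx0.
apply: obs => u; have [w E] := GR_head_word u k.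
by rewrite mulmxA E v0.
Qed.

Lemma trf_GR n (W : 'I_N -> 'M[C]_n) :
  trf blk A B K D W = fm_eval GR_fm W.
Proof.
rewrite /trf /obs /fm_eval /fm_obs -!lock -mulmxA tsum_tens.
congr (_ + _ *m _); apply: eq_tsum => k //; by rewrite mulmx1.
Qed.

End Bridge.

(** * Factorization of positive semidefinite matrices *)

Section Positive.
Variable C : numClosedFieldType.

Lemma psd_sqrt n (G : 'M[C]_n) : G ^t* = G ->
    (forall v : 'cV_n, 0 <= (v ^t* *m G *m v) 0 0) ->
  exists S : 'M[C]_n, G = S *m S ^t*.
Proof.
move=> GC Gpos; have /hermitian_normalmx/orthomx_spectralP : G \is hermsymmx.
  exact/hermsymmxP.
set P := spectralmx G; set d := spectral_diag G => GE.
have Pu : P \is unitarymx := spectral_unitarymx G.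
have d0 i : 0 <= d 0 i.
  have := Gpos (P ^t* *m delta_mx i 0).
  rewrite {1}GE invmx_unitary // trmxC_mul trmxCK !mulmxA.
  rewrite -[_ *m P *m P ^t*]mulmxA (unitarymxP Pu) mulmx1.
  rewrite -[_ *m P *m P ^t*]mulmxA (unitarymxP Pu) mulmx1.
  rewrite -mulmxA -colE mxE (bigD1 i) //= big1 ?addr0 => [|j /negPf ji].
    by rewrite !mxE !eqxx rmorph1 mul1r mulr1n.
  by rewrite !mxE ji rmorph0 mul0r.
exists (P ^t* *m diag_mx (map_mx sqrtC d)).
rewrite GE invmx_unitary // trmxC_mul trmxCK mulmxA; congr (_ *m _).
rewrite -mulmxA tr_diag_mx map_diag_mx mulmx_diag; congr (_ *m diag_mx _).
apply/rowP => i; rewrite !mxE -[X in _ = _ * X]/((sqrtC _)^*).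
by rewrite geC0_conj ?sqrtC_ge0 // -expr2 sqrtCK.
Qed.

End Positive.

(** * Block diagonal matrices *)

Section BlockDiagonal.
Variables (C : numClosedFieldType) (N : nat) (r : 'I_N -> nat).

Lemma eq_bproj n (M M' : 'M[C]_(\sum_k r k, n)) :
  (forall k, bproj k *m M = bproj k *m M') -> M = M'.
Proof.
by move=> MM'; apply/mxcolP => k; rewrite !submxcol_bproj MM'.
Qed.

Lemma mxdiag_bprojE (S : forall k, 'M[C]_(r k)) :
  \mxdiag_k S k = \sum_k (bproj k)^T *m S k *m bproj k.
Proof.
rewrite -[LHS]mul1mx -sum_bproj mulmx_suml; apply: eq_bigr => k _.
by rewrite -!mulmxA bproj_mxdiag.
Qed.

Lemma mxdiag_trbproj (S : forall k, 'M[C]_(r k)) k :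
  (\mxdiag_j S j) *m (bproj k)^T = (bproj k)^T *m S k.
Proof.
rewrite mxdiag_bprojE mulmx_suml [LHS](bigD1 k) //= [X in _ + X]big1 => [|j jk].
  by rewrite addr0 -mulmxA bprojK mulmx1.
by rewrite -mulmxA bproj_ortho // mulmx0.
Qed.

Lemma mxdiagM (S T : forall k, 'M[C]_(r k)) :
  (\mxdiag_k S k) *m (\mxdiag_k T k) = \mxdiag_k (S k *m T k).
Proof.
by apply: eq_bproj => k; rewrite mulmxA !bproj_mxdiag -mulmxA bproj_mxdiag mulmxA.
Qed.

Lemma trmxC_mxdiag (S : forall k, 'M[C]_(r k)) :
  (\mxdiag_k S k) ^t* = \mxdiag_k ((S k) ^t*).
Proof.
rewrite !mxdiag_bprojE trmxC_sum; apply: eq_bigr => k _.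
rewrite !trmxC_mul mulmxA; congr (_ *m _ *m _); first exact: bprojC.
by rewrite trmxK; apply/matrixP => i j; rewrite !mxE rmorph_nat.
Qed.

Lemma mxdiag_unit (S : forall k, 'M[C]_(r k)) :
  (\mxdiag_k S k \in unitmx) <-> (forall k, S k \in unitmx).
Proof.
split=> [uS k|uS].
  apply: row_inj_unitmx => u uS0.
  have : u *m bproj k = 0.
    by apply: (row_unitmx0 uS); rewrite -mulmxA bproj_mxdiag mulmxA uS0 mul0mx.
  move/(congr1 (fun M => M *m (bproj k)^T)).
  by rewrite -mulmxA bprojK mulmx1 mul0mx.
suff /mulmx1_unit[] : \mxdiag_k S k *m \mxdiag_k invmx (S k) = 1%:M by [].
rewrite mxdiagM -(mxdiagZ 1); apply: eq_mxdiag => k.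
by rewrite mulmxV.
Qed.

Lemma bproj_invmx_mxdiag (S : forall k, 'M[C]_(r k)) k :
  (forall j, S j \in unitmx) ->
  bproj k *m invmx (\mxdiag_j S j) = invmx (S k) *m bproj k.
Proof.
move=> uS; have uT : \mxdiag_j S j \in unitmx by apply/mxdiag_unit.
apply: (canRL (mulKmx (uS k))); rewrite mulmxA -bproj_mxdiag -mulmxA.
by rewrite mulmxV // mulmx1.
Qed.

End BlockDiagonal.

(** * Block diagonal similarity of GR-nodes *)

Section Similarity.
Variables (C : numClosedFieldType) (N q : nat) (r : 'I_N -> nat).

Definition GR_similar (alpha : GR_node C q r) (S : forall k, 'M[C]_(r k)) :
    GR_node C q r :=
  let T := \mxdiag_k S k in
  GRNode (invmx T *m GR_A alpha *m T) (invmx T *m GR_B alpha)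
    (GR_C alpha *m T) (GR_D alpha).

Lemma GR_transfer_similar alpha (S : forall k, 'M[C]_(r k)) :
  (forall k, S k \in unitmx) ->
  GR_transfer (GR_similar alpha S) =1 GR_transfer alpha.
Proof.
move=> uS; have tE w k :
    GR_tail (GR_similar alpha S) w k = invmx (S k) *m GR_tail alpha w k.
  elim: w k => [|j w IHw] k /=.
    by rewrite !submxcol_bproj mulmxA bproj_invmx_mxdiag // -mulmxA.
  rewrite IHw !submxblock_bproj !mulmxA bproj_invmx_mxdiag //.
  by rewrite -[_ *m (\mxdiag_k S k) *m _]mulmxA mxdiag_trbproj !mulmxA mulmxK.
case=> [|j w] //=.
rewrite tE !submxrow_bproj -[_ *m _ *m (bproj j)^T]mulmxA mxdiag_trbproj.
by rewrite !mulmxA mulmxK.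
Qed.

Definition colligation (alpha : GR_node C q r) :=
  block_mx (GR_A alpha) (GR_B alpha) (GR_C alpha) (GR_D alpha).

Lemma colligation_similar alpha (S : forall k, 'M[C]_(r k)) :
  colligation (GR_similar alpha S) =
  block_mx (invmx (\mxdiag_k S k)) 0 0 1%:M *m colligation alpha *m
    block_mx (\mxdiag_k S k) 0 0 1%:M.
Proof.
rewrite /colligation !mulmx_block !mul0mx !mulmx0 !mul1mx !mulmx1.
by rewrite !addr0 !add0r.
Qed.

Lemma trmxC_block_diag m n (M : 'M[C]_m) (M' : 'M[C]_n) :
  (block_mx M 0 0 M') ^t* = block_mx (M ^t*) 0 0 (M' ^t*).
Proof. by rewrite tr_block_mx map_block_mx !trmx0 !map_mx0. Qed.

Lemma mul_block_diag m n (M L : 'M[C]_m) (M' L' : 'M[C]_n) :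
  block_mx M 0 0 M' *m block_mx L 0 0 L' = block_mx (M *m L) 0 0 (M' *m L').
Proof. by rewrite mulmx_block !mul0mx !mulmx0 !addr0 !add0r. Qed.

End Similarity.

(** * Matrix-J-inner series *)

Section Main.
Variables (C : numClosedFieldType) (N q : nat) (J : 'M[C]_q) (f : mxfps C N q).
Hypotheses (hJ : signature_mx J) (hrat : mxfps_rational f).

Let JC : J ^t* = J. Proof. by case: hJ => /hermsymmxP. Qed.
Let J2 : J *m J = 1%:M. Proof. by case: hJ. Qed.

Lemma rational_minimal : exists (r : 'I_N -> nat) (alpha : GR_node C q r),
  GR_minimal_realization alpha f.
Proof.
have [a [Q [_ aE _]]] := matrix_rational_fm hrat.
have [r [alpha alphaE]] := fm_to_GR a.
have [s [beta [bE bmin]]] := minimal_exists alpha.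
have E : GR_transfer alpha =1 f by move=> w; rewrite alphaE aE.
exists s, beta; split=> [w|t gamma gE]; first by rewrite bE E.
by apply: (bmin _ gamma) => w; rewrite gE E.
Qed.

Hypothesis hinner : matrix_J_inner J f.

Lemma inner_gramian r (alpha : GR_node C q r) :
    GR_minimal_realization alpha f ->
  exists G, [/\ forall k, blk k *m G = G *m blk k, G ^t* = G, G \in unitmx,
    forall v : 'cV_(\sum_k r k), 0 <= (v ^t* *m G *m v) 0 0 &
    colligation alpha *m block_mx G 0 0 J *m (colligation alpha) ^t* =
      block_mx G 0 0 J].
Proof.
move=> amin; have [ctr obs] := minimal_ctr_obs amin.
have [a [Q0 [regQ0 aE aev]]] := matrix_rational_fm hrat.
(* On [Q] the value of f through rational expressions, realized by [a], and the resolvent of the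
   minimal node both exist, and [fm_eval_eq] identifies f(W) with [trf]. *)
pose Q n (W : 'I_N -> 'M[C]_n) := Q0 n W /\ fm_pencil (GR_fm alpha) W \in unitmx.
have regQ : regular Q by apply: regularI => //; apply: regular_pencil.
have QP n (W : 'I_N -> 'M[C]_n) : Q n W ->
    pencil (fun k => blk k *m GR_A alpha) W \in unitmx by case.
have Qf n (W : 'I_N -> 'M[C]_n) : Q n W -> mxfps_value f W
    (trf blk (GR_A alpha) (GR_B alpha) (GR_C alpha) (GR_D alpha) W).
  case=> /aev[ua fW] uW; rewrite trf_GR (_ : fm_eval _ W = fm_eval a W) //.
  apply: fm_eval_eq => // w.
  by rewrite fm_coef_GR aE; apply: (proj1 amin).
have [hunit hcontr] := hinner.
have trfJ n (W : 'I_N -> 'M[C]_n) : (forall k, W k \is unitarymx) -> Q n W -> _ :=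
  fun uW QW => hunit n W _ uW (Qf n W QW).
have trfc n (W : 'I_N -> 'M[C]_n) :
  (forall k, lemx (W k *m (W k) ^t*) 1%:M) -> Q n W -> _ :=
  fun cW QW => hcontr n W _ cW (Qf n W QW).
have Kobs := observable_blk obs; have Bctr := controllable_blk ctr.
have [G [GP GC Gscat GU]] := colligation_J (blkC C r) (@blkM C N r)
  (sum_blk C r) JC regQ QP trfJ Kobs.
exists G; split=> //.
  exact: (gramian_unit (sum_blk C r) J2 regQ trfJ Bctr GP Gscat).
exact: (gramian_ge0 (blkC C r) (@blkM C N r) (sum_blk C r) regQ QP Kobs trfc
  GP GU).
Qed.

Lemma inner_realization : exists (r : 'I_N -> nat) (alpha : GR_node C q r),
  GR_minimal_realization alpha f /\ structured_hermitian_of alpha J 1%:M.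
Proof.
have [r [alpha amin]] := rational_minimal; exists r.
have [G [GP GC uG Gpos GU]] := inner_gramian amin.
(* The factorization is carried out block by block, to keep the similarity block diagonal. *)
have GE := mxdiag_of_comm GP.
set Gk := (fun k => bproj k *m G *m (bproj k)^T) in GE.
have bprojC' k : (bproj k)^T ^t* = bproj k :> 'M[C]_(r k, _).
  by rewrite trmxK; apply/matrixP => i j; rewrite !mxE rmorph_nat.
have GkC k : (Gk k) ^t* = Gk k.
  by rewrite /Gk !trmxC_mul GC bprojC' mulmxA; congr (_ *m _); apply: bprojC.
have Gkpos k (v : 'cV_(r k)) : 0 <= (v ^t* *m Gk k *m v) 0 0.
  have := Gpos ((bproj k)^T *m v).
  by rewrite trmxC_mul bprojC' !mulmxA.
have ex_S k : exists S, Gk k = S *m S ^t* := psd_sqrt (GkC k) (Gkpos k).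
have {ex_S}/(@fin_all_exists _ (fun k => 'M[C]_(r k)))[S SE] := ex_S.
have SG : \mxdiag_k S k *m (\mxdiag_k S k) ^t* = G.
  rewrite trmxC_mxdiag mxdiagM [RHS]GE; apply: eq_mxdiag => k.
  by rewrite -SE.
have uS : \mxdiag_k S k \in unitmx by move: uG; rewrite -SG unitmx_mul => /andP[].
have uSk : forall k, S k \in unitmx by apply/mxdiag_unit.
set T := \mxdiag_k S k in SG uS.
pose beta := GR_similar alpha S; exists beta; split.
  split=> [w|s gamma].
    by rewrite GR_transfer_similar //; apply: (proj1 amin).
  exact: (proj2 amin).
have J2' : block_mx 1%:M 0 0 J *m block_mx 1%:M 0 0 J =
    1%:M :> 'M[C]_(\sum_k r k + q).
  by rewrite mul_block_diag mul1mx J2 -scalar_mx_block.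
split.
- by exists (fun k => 1%:M); rewrite mxdiagZ.
- by apply/hermsymmxP; rewrite trmxC1.
- exact: unitmx1.
rewrite -/(colligation beta).
have UU : colligation beta *m block_mx 1%:M 0 0 J *m (colligation beta) ^t* =
    block_mx 1%:M 0 0 J.
  rewrite /beta colligation_similar -/T; set U := colligation alpha in GU *.
  rewrite !trmxC_mul !trmxC_block_diag trmxC1 !mulmxA.
  rewrite -[_ *m block_mx T 0 0 1%:M *m _]mulmxA mul_block_diag mulmx1 mul1mx.
  rewrite -[_ *m _ *m block_mx (T ^t*) 0 0 1%:M]mulmxA mul_block_diag mulmx1 SG.
  rewrite -[block_mx _ _ _ _ *m U *m _]mulmxA -[_ *m (U *m _) *m _]mulmxA GU.
  rewrite !mul_block_diag mul1mx mulmx1 -SG mulmxA mulVmx // mul1mx.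
  by rewrite -trmxC_mul mulVmx // trmxC1.
(* As 1 + J is its own inverse, (1 + J) U^H (1 + J) is a right inverse of U; being also a left
   inverse, it gives the identity with U and U^H exchanged. *)
have : colligation beta *m (block_mx 1%:M 0 0 J *m (colligation beta) ^t* *m
    block_mx 1%:M 0 0 J) = 1%:M by rewrite !mulmxA UU J2'.
move/mulmx1C => E; rewrite -[LHS]mul1mx -J2' -[_ *m _ *m (_ *m _)]mulmxA.
by rewrite !mulmxA in E *; rewrite -!mulmxA in E *; rewrite E mulmx1.
Qed.

Lemma inner_unique (r : 'I_N -> nat) (a1 a2 : GR_node C q r) :
    GR_minimal_realization a1 f -> structured_hermitian_of a1 J 1%:M ->
    GR_minimal_realization a2 f -> structured_hermitian_of a2 J 1%:M ->
  unitarily_similar a1 a2.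
Proof.
move=> m1 [_ _ _ U1] m2 [_ _ _ U2].
have [T [uT TA TB TC]] := minimal_similar m1 m2.
have [ctr _] := minimal_ctr_obs m1.
have D12 : GR_D a1 = GR_D a2 := etrans (proj1 m1 [::]) (esym (proj1 m2 [::])).
set S := \mxdiag_k T k.
have uS : S \in unitmx by apply/mxdiag_unit.
have SA : S *m GR_A a1 = GR_A a2 *m S.
  apply/mxblockP => i j; rewrite !submxblock_bproj mulmxA bproj_mxdiag.
  rewrite -[_ *m (_ *m S) *m _]mulmxA -[GR_A a2 *m S *m _]mulmxA mxdiag_trbproj.
  by have := TA i j; rewrite !submxblock_bproj !mulmxA.
have SB : S *m GR_B a1 = GR_B a2.
  apply: eq_bproj => k; rewrite mulmxA bproj_mxdiag.
  by have := TB k; rewrite !submxcol_bproj mulmxA.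
have SC : GR_C a1 = GR_C a2 *m S.
  apply/mxrowP => k; rewrite !submxrow_bproj -mulmxA mxdiag_trbproj.
  by have := TC k; rewrite !submxrow_bproj mulmxA.
split=> //; exists T; last first.
  split; rewrite -/S.
  - by rewrite -mulmxA -SA mulKmx.
  - by rewrite -SB mulKmx.
  - exact: SC.
set I := block_mx 1%:M 0 0 J in U1 U2.
have I2 : I *m I = 1%:M by rewrite mul_block_diag mul1mx J2 -scalar_mx_block.
pose H := S ^t* *m S.
have U12 : block_mx S 0 0 1%:M *m colligation a1 =
    colligation a2 *m block_mx S 0 0 1%:M.
  rewrite /colligation !mulmx_block !mul0mx !mulmx0 !mul1mx !mulmx1.
  by rewrite !addr0 !add0r SA SB SC D12.
(* The similarity pulls the invariance of [I] under the second system matrix back to that of H + J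
   under the first. *)
have UH : (colligation a1) ^t* *m block_mx H 0 0 J *m colligation a1 =
    block_mx H 0 0 J.
  have HE : block_mx H 0 0 J =
      (block_mx S 0 0 1%:M) ^t* *m I *m block_mx S 0 0 1%:M.
    by rewrite trmxC_block_diag trmxC1 !mul_block_diag mulmx1 mul1mx mulmx1.
  rewrite {1}HE !mulmxA -trmxC_mul U12 -mulmxA U12 trmxC_mul !mulmxA.
  rewrite -[_ *m (colligation a2) ^t* *m _]mulmxA.
  rewrite -[_ *m (_ *m I) *m colligation a2]mulmxA U2.
  by rewrite -HE.
have UI : colligation a1 *m (I *m (colligation a1) ^t* *m I) = 1%:M.
  by apply: mulmx1C; rewrite -!mulmxA (mulmxA _ I) U1 I2.
(* Multiplying U^H (H + J) U = H + J on the left by U I, where U I U^H = I, gives I (H + J) U = U I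
   (H + J). *)
have UX : block_mx H 0 0 1%:M *m colligation a1 =
    colligation a1 *m block_mx H 0 0 1%:M.
  have IH : I *m block_mx H 0 0 J = block_mx H 0 0 1%:M.
    by rewrite mul_block_diag mul1mx J2.
  rewrite -{2}IH -UH !mulmxA.
  have -> : colligation a1 *m I *m (colligation a1) ^t* = I.
    by rewrite -[I in RHS]mul1mx -UI -!mulmxA I2 mulmx1.
  by rewrite IH.
move: UX; rewrite /colligation !mulmx_block !mul0mx !mulmx0 !mul1mx !mulmx1.
rewrite !addr0 !add0r => /eq_block_mx[HA HB _ _].
have Hk k : bproj k *m H = ((T k) ^t* *m T k) *m bproj k.
  rewrite /H trmxC_mxdiag mxdiagM bproj_mxdiag //.
suff TT k : (T k) ^t* *m T k = 1%:M.
  by move=> k; apply/unitarymxP; apply: mulmx1C.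
(* From H A = A H and H B = B, induction on the word shows that T_k^H T_k fixes every tail. *)
apply: (controllable_mx ctr) => w; rewrite mul1mx.
elim: w k => [|j w IHw] k /=.
  by rewrite submxcol_bproj mulmxA -Hk -mulmxA HB.
rewrite submxblock_bproj !mulmxA -Hk -[_ *m H *m _]mulmxA HA mulmxA.
rewrite -[_ *m H *m (bproj j)^T]mulmxA.
have -> : H *m (bproj j)^T = (bproj j)^T *m ((T j) ^t* *m T j).
  by rewrite /H trmxC_mxdiag mxdiagM mxdiag_trbproj.
by rewrite -!mulmxA [(T j) ^t* *m (T j *m _)]mulmxA IHw.
Qed.

End Main.

Theorem theorem6p4 (R : realType) (N q : nat) (J : 'M[R[i]]_q)
    (f : mxfps R[i] N q)
    (hJ : signature_mx J) (hrat : mxfps_rational f)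
    (hinner : matrix_J_inner J f) :
  (exists (gamma : 'I_N -> nat) (alpha : GR_node R[i] q gamma),
     GR_minimal_realization alpha f /\
     structured_hermitian_of alpha J 1%:M)
  /\
  (forall (gamma1 gamma2 : 'I_N -> nat)
     (alpha1 : GR_node R[i] q gamma1) (alpha2 : GR_node R[i] q gamma2),
     GR_minimal_realization alpha1 f -> structured_hermitian_of alpha1 J 1%:M ->
     GR_minimal_realization alpha2 f -> structured_hermitian_of alpha2 J 1%:M ->
     exists e : gamma1 = gamma2,
       unitarily_similar (ecast g (GR_node R[i] q g) e alpha1) alpha2).
Proof.
split; first exact: inner_realization.
move=> g1 g2 a1 a2 m1 s1 m2 s2.
(* Each minimal realization bounds the block dimensions of the other; after substitution the cast is
   trivial. *)
have g12 : g1 = g2.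
  apply: functional_extensionality_dep => k; apply/eqP; rewrite eqn_leq.
  by rewrite (proj2 m1 _ _ (proj1 m2)) (proj2 m2 _ _ (proj1 m1)).
subst g2; exists erefl; exact: (inner_unique hJ m1 s1 m2 s2).
Qed.
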